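(* Suppose $t_0=(\mathbf x_0,\tilde B_0)$ is a primitive cluster algebra seed where $\tilde B_0$ is a full rank matrix. Then the cluster algebra $\mathcal A_{CA}(t_0)$ of geometric type generated by $(\mathbf x_0,\tilde B_0)$, with each seed $(\mathbf x,\tilde B)$ regarded as the pair $(\mathbf x,\mathbf F)$ of the cluster and its associated exchange polynomials, is a Laurent phenomenon algebra; and for every seed in $\mathcal A_{CA}(t_0)$, cluster algebra seed mutation agrees with LP algebra seed mutation, i.e. for every seed $(\mathbf x,\tilde B)$ of $\mathcal A_{CA}(t_0)$ with associated pair $(\mathbf x,\mathbf F)$ and every $i\in[n]$, the pair associated to the cluster algebra mutation of $(\mathbf x,\tilde B)$ at $i$ is an LP mutation of $(\mathbf x,\mathbf F)$ at $i$.
   Context: Cluster algebras of geometric type. Let $m\ge n\ge1$ and $S=\mathbb Z[x_{n+1}^{\pm1},\dots,x_m^{\pm1}]$, and let $\mathcal F$ be the field of rational functions in $n$ independent variables over $\mathrm{Frac}(S)$. A cluster algebra seed in $\mathcal F$ is a pair $(\mathbf x,\tilde B)$ with $\mathbf x=\{x_1,\dots,x_n\}$ a transcendence basis of $\mathcal F$ over $\mathrm{Frac}(S)$ and $\tilde B=(b_{ij})$ an $m\times n$ integer matrix whose top $n\times n$ submatrix $B$ is skew-symmetrizable (there is a diagonal matrix $D$ with positive diagonal entries such that $DB$ is skew-symmetric). The seed (or $\tilde B$) is primitive if each column of $\tilde B$ is a primitive vector of $\mathbb Z^m$, i.e. nonzero with greatest common divisor of entries equal to $1$. The associated exchange polynomials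 are $F_j=\prod_{b_{ij}>0}x_i^{b_{ij}}+\prod_{b_{ij}<0}x_i^{-b_{ij}}$ for $j\in[n]=\{1,\dots,n\}$. The cluster algebra mutation at $i\in[n]$ is $(\mathbf x',\tilde B')$ with $x_i'=F_i/x_i$, $x_j'=x_j$ for $j\ne i$, and $b'_{kj}=-b_{kj}$ if $k=i$ or $j=i$, $b'_{kj}=b_{kj}+\frac{|b_{ki}|b_{ij}+b_{ki}|b_{ij}|}{2}$ otherwise. The cluster algebra $\mathcal A_{CA}(t_0)$ is the collection of all seeds obtained from $t_0$ by successive mutations, together with the subring of $\mathcal F$ generated over $S$ by all cluster variables in these seeds. LP seeds. Let $S$ be a unique factorization domain and $\mathcal F$ the field of rational functions in $n$ independent variables over $\mathrm{Frac}(S)$. An LP seed of rank $n$ in $\mathcal F$ is a pair $(\mathbf x,\mathbf F)$ where $\mathbf x=\{x_1,\dots,x_n\}$ is a transcendence basis of $\mathcal F$ over $\mathrm{Frac}(S)$, and $\mathbf F=\{F_1,\dots,F_n\}$ are polynomials in $\mathcal P=S[x_1,\dots,x_n]$ such that (LP1) each $F_i$ is irreducible in $\mathcal P$ and not divisible by any $x_j$; (LP2) $F_i$ does not involve $x_i$. Sets are unordered, but it is recorded which $F_i$ belongs to which $x_i$. Write $f\propto g$ if $f,g$ differ multiplicatively by a unit of $S$. Exchange Laurent polynomials. For an LP seed, $\hat F_1,\dots,\hat F_n\in S[x_1^{\pm1},\dots,x_n^{\pm1}]$ are the unique elements such that $\hat F_i=\big(\prod_{k\ne i}x_k^{a_k}\big)F_i$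 for some integers $a_k\le 0$, and for all $j\neq i$ the element $\hat F_i|_{x_j\leftarrow F_j/x}$ lies in $S[x_1^{\pm1},\dots,x_{j-1}^{\pm1},x^{\pm1},x_{j+1}^{\pm1},\dots,x_n^{\pm1}]$ and is not divisible by $F_j$ in this ring. LP mutation. For $i\in[n]$, $(\mathbf x',\mathbf F')$ is obtained from the LP seed $(\mathbf x,\mathbf F)$ by LP mutation at $i$ if it results from the following non-deterministic procedure. Put $x_i'=\hat F_i/x_i$ and $x_j'=x_j$ for $j\ne i$; $F_i'=F_i$. For $j\neq i$: if $F_j$ does not depend on $x_i$, then $F_j'$ is any polynomial in $\mathcal P'=S[x_1',\dots,x_n']$ with $F'_j\propto F_j$. If $F_j$ depends on $x_i$ (in which case $\hat F_i|_{x_j\leftarrow 0}$ is defined), put $G_j=F_j|_{x_i\leftarrow (\hat F_i|_{x_j\leftarrow0})/x_i'}$; let $H_j$ be $G_j$ with all common factors in $S[x_k:k\ne i,j]$ with $\hat F_i|_{x_j\leftarrow 0}$ removed (every irreducible factor of $\hat F_i|_{x_j\leftarrow0}$ is divided out of $G_j$ to the full power to which it divides $G_j$, monomials being immaterial); finally $F_j'=MH_j$ where $M$ is a Laurent monomial in the $x_k'$, $k\neq j$, with coefficient a unit in $S$, such that $F_j'\in\mathcal P'$, $F'_j$ does not involve $x'_j$, and $F_j'$ is not divisible by any variable of $\mathcal P'$. LP algebras. A Laurent phenomenon (LP) algebra of rank $n$ is a subring $\mathcal A\subset\mathcal F$ together with a distinguished collection of LP seeds in $\mathcal F$ such that: for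 each seed of the collection and each $i\in[n]$ we are given a seed of the collection obtained from it by LP mutation at $i$; all seeds are connected by mutations; and $\mathcal A$ is generated over $S$ by all cluster variables of all the seeds. *)

(* Defs.v *)
From HB Require Import structures.
From Stdlib Require Import Relation_Operators.
From mathcomp Require Import all_boot all_order all_algebra.
From mathcomp Require Import boolp.
From mathcomp Require Import mpoly.

Set Implicit Arguments.
Unset Strict Implicit.
Unset Printing Implicit Defensive.

Import GRing.Theory.
Local Open Scope ring_scope.

Notation "x %:F" := (FracField.tofrac x) : ring_scope.

Definition irreducible (R : idomainType) (p : R) : Prop :=
  p \isn't a GRing.unit /\
  forall a b : R, p = a * b -> a \is a GRing.unit \/ b \is a GRing.unit.

Definition rdvd (R : idomainType) (p q : R) : Prop := exists c : R, q = c * p.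

Definition associated (R : idomainType) (p q : R) : Prop :=
  exists2 u : R, u \is a GRing.unit & p = u * q.

Definition is_UFD (R : idomainType) : Prop :=
  (forall p : R, p != 0 -> p \isn't a GRing.unit ->
     exists2 s : seq R, (forall q, q \in s -> irreducible q)
                      & p = \prod_(q <- s) q) /\
  (forall s t : seq R,
     (forall q, q \in s -> irreducible q) ->
     (forall q, q \in t -> irreducible q) ->
     \prod_(q <- s) q = \prod_(q <- t) q ->
     exists t' : seq R, [/\ perm_eq t t', size s = size t'
       & forall k, (k < size s)%N -> associated s`_k t'`_k]).

(* The Laurent polynomial ring R[X_1^{+-1}, ..., X_n^{+-1}] is built as *)
(* a subring of the field of fractions of R[X_1, ..., X_n].             *)

Definition is_laurent (R : idomainType) (n : nat)
    (q : {fraction {mpoly R[n]}}) : Prop :=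
  exists (p : {mpoly R[n]}) (a : 'X_{1..n}), q = p%:F / ('X_[a])%:F.

Section LaurentRing.
Variables (R : idomainType) (n : nat).

Definition laurent_pred : {pred {fraction {mpoly R[n]}}} :=
  fun q => `[< is_laurent q >].

Fact laurent_subring : subring_closed laurent_pred.
Proof.
have nzX (a : 'X_{1..n}) : ('X_[a] : {mpoly R[n]})%:F != 0.
  by rewrite tofrac_eq0 -msupp_eq0 msuppX.
split.
- by apply/asboolP; exists 1, 0%MM; rewrite mpolyX0 tofrac1 divr1.
- move=> u v /asboolP[p [a ->]] /asboolP[q [b ->]]; apply/asboolP.
  exists (p * 'X_[b] - q * 'X_[a]), (a + b)%MM.
  rewrite mpolyXD tofracB !tofracM -mulNr addf_div //.
  by rewrite mulNr.
- move=> u v /asboolP[p [a ->]] /asboolP[q [b ->]]; apply/asboolP.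
  by exists (p * q), (a + b)%MM; rewrite mpolyXD !tofracM mulf_div.
Qed.

HB.instance Definition _ :=
  GRing.isSubringClosed.Build {fraction {mpoly R[n]}} laurent_pred
    laurent_subring.

Record laurent := Laurent {
  laurent_val : {fraction {mpoly R[n]}};
  _ : laurent_val \in laurent_pred }.

HB.instance Definition _ := [isSub for laurent_val].
HB.instance Definition _ := [Choice of laurent by <:].
HB.instance Definition _ := [SubChoice_isSubComNzRing of laurent by <:].

Definition laurent_unit : pred laurent :=
  fun u => (val u != 0) && ((val u)^-1 \in laurent_pred).

Definition laurent_inv (u : laurent) : laurent :=
  if val u == 0 then u else insubd u (val u)^-1.

Fact laurent_mulVr : {in laurent_unit, left_inverse 1 laurent_inv *%R}.
Proof.
move=> u /andP[u0 uV]; apply: val_inj.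
change (val (laurent_inv u) * val u = 1).
by rewrite /laurent_inv (negPf u0) insubdK // mulVf.
Qed.

Fact laurent_unitP (u v : laurent) : v * u = 1 -> laurent_unit u.
Proof.
move=> /(congr1 val) vu1; change (val v * val u = 1) in vu1.
have u0 : val u != 0.
  by apply: contra_eq_neq vu1 => ->; rewrite mulr0 eq_sym oner_neq0.
rewrite /laurent_unit u0 /=; suff -> : (val u)^-1 = val v by apply: valP.
by apply: (mulIf u0); rewrite mulVf // vu1.
Qed.

Fact laurent_inv_out : {in [predC laurent_unit], laurent_inv =1 id}.
Proof.
move=> u; rewrite inE negb_and negbK /laurent_inv => /orP[-> //|uV].
by case: ifP => // _; rewrite /insubd insubN.
Qed.

HB.instance Definition _ := GRing.ComNzRing_hasMulInverse.Build laurent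
  laurent_mulVr laurent_unitP laurent_inv_out.

Fact laurent_idomain : GRing.integral_domain_axiom laurent.
Proof.
move=> u v /(congr1 val) uv0; change (val u * val v = 0) in uv0.
by move/eqP: uv0; rewrite mulf_eq0.
Qed.

HB.instance Definition _ :=
  GRing.ComUnitRing_isIntegral.Build laurent laurent_idomain.

Fact laurent_varP (i : 'I_n) : ('X_i : {mpoly R[n]})%:F \in laurent_pred.
Proof. by apply/asboolP; exists 'X_i, 0%MM; rewrite mpolyX0 tofrac1 divr1. Qed.

Definition laurent_var (i : 'I_n) : laurent := Laurent (laurent_varP i).

End LaurentRing.

(* Laurent phenomenon algebras over S, in the field F of rational       *)
(* functions in n variables over Frac(S).                               *)
(*                                                                      *)
(* A seed is labelled by 'I_n.  As its cluster x is algebraically       *)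
(* independent, S[x_1, ..., x_n] is identified with {mpoly S[n]}, 'X_k  *)
(* standing for x_k; after a mutation at i, 'X_i stands for x_i'.       *)

Section LPAlgebras.
Variables (S : idomainType) (n : nat).

Local Notation P := {mpoly S[n]}.
Local Notation Q := {fraction {mpoly S[n]}}.
Local Notation K := {fraction S}.
Local Notation F := {fraction {mpoly {fraction S}[n]}}.

Definition ground (s : S) : F := (s%:F)%:MP%:F.

Definition eval_frac (x : 'I_n -> F) (p : {mpoly K[n]}) : F :=
  mmap (fun c : K => c%:MP%:F : F) x p.

Definition in_adjoin (x : 'I_n -> F) (u : F) : Prop :=
  exists p q : {mpoly K[n]}, u = eval_frac x p / eval_frac x q.

Definition transcendence_basis (x : 'I_n -> F) : Prop :=
  (forall p : {mpoly K[n]}, eval_frac x p = 0 -> p = 0) /\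
  (forall u : F, exists q : {poly F},
     [/\ q != 0, forall k, in_adjoin x q`_k & root q u]).

Definition free_of (i : 'I_n) (p : P) : bool :=
  all (fun m : 'X_{1..n} => m i == 0%N) (msupp p).

Record LPseed := MkLPseed {
  cluster : {ffun 'I_n -> F};
  expoly : {ffun 'I_n -> P} }.

Definition is_LPseed (t : LPseed) : Prop :=
  [/\ transcendence_basis (cluster t),
      forall i, irreducible (expoly t i),
      forall i j, ~ rdvd 'X_j (expoly t i)
    & forall i, free_of i (expoly t i)].

(* The value at y of the Laurent polynomial (prod_k x_k^(a_k)) * p, the *)
(* coefficients being mapped by h.  When y_j = 0 this is meaningful for *)
(* a_j = 0 (then y_j ^ a_j = 1).                                        *)
Definition leval (E : fieldType) (h : S -> E) (a : 'I_n -> int) (p : P)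
    (y : 'I_n -> E) : E :=
  (\prod_(k < n) y k ^ a k) * mmap h y p.

Definition cstQ (s : S) : Q := s%:MP%:F.

Definition varQ (k : 'I_n) : Q := ('X_k : P)%:F.

Definition set_var (j : 'I_n) (v : Q) (k : 'I_n) : Q :=
  if k == j then v else varQ k.

Definition ldvd (q1 q2 : Q) : Prop := exists2 h : Q, is_laurent h & q2 = h * q1.

(* a is the exponent vector of the monomial in                          *)
(* hat F_i = (prod_(k != i) x_k^(a_k)) * F_i.  In the substitution      *)
(* x_j <- F_j / x the new variable x is again written 'X_j, which no    *)
(* longer occurs otherwise since F_j is free of x_j.                    *)
Definition is_hat_exponent (f : 'I_n -> P) (i : 'I_n) (a : 'I_n -> int) : Prop :=
  [/\ a i = 0, forall k, a k <= 0
    & forall j, j != i ->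
        let q := leval cstQ a (f i) (set_var j ((f j)%:F / varQ j)) in
        is_laurent q /\ ~ ldvd (f j)%:F q].

Definition hat_at0 (f : 'I_n -> P) (a : 'I_n -> int) (i j : 'I_n) : Q :=
  leval cstQ a (f i) (set_var j 0).

(* p ranges over the irreducible elements of S[x_k : k != i, j], the    *)
(* variables being discarded: Laurent monomials are immaterial, so      *)
(* divisibility is taken in the Laurent ring, where variables are units. *)
Definition factor_of (i j : 'I_n) (c : Q) (p : P) : Prop :=
  [/\ irreducible p, free_of i p && free_of j p,
      forall k, ~ rdvd 'X_k p & ldvd p%:F c].

Definition common_factors_removed (i j : 'I_n) (c G H : Q) : Prop :=
  [/\ is_laurent H,
      exists2 s : seq P, (forall p, p \in s -> factor_of i j c p)
                       & G = (\prod_(p <- s) p)%:F * H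
    & forall p, factor_of i j c p -> ~ ldvd p%:F H].

Definition unit_proportional (p q : P) : Prop :=
  exists2 u : S, u \is a GRing.unit & p = u *: q.

Definition LP_mutation (t : LPseed) (i : 'I_n) (t' : LPseed) : Prop :=
  let x := cluster t in let f := expoly t in
  let x' := cluster t' in let f' := expoly t' in
  exists2 a : 'I_n -> int, is_hat_exponent f i a &
  [/\ x' i = leval ground a (f i) x / x i,
      forall j, j != i -> x' j = x j,
      f' i = f i,
      forall j, j != i -> free_of i (f j) -> unit_proportional (f' j) (f j)
    & forall j, j != i -> ~~ free_of i (f j) ->
        let c := hat_at0 f a i j in
        let G := mmap cstQ (set_var i (c / varQ i)) (f j) in
        [/\ (* hat F_i is defined at x_j = 0 *)
            a j = 0,
            exists H : Q, common_factors_removed i j c G H /\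
              exists (u : S) (b : 'I_n -> int),
                [/\ u \is a GRing.unit, b j = 0
                  & (f' j)%:F = cstQ u * (\prod_(k < n) varQ k ^ b k) * H],
            free_of j (f' j)
          & forall k, ~ rdvd 'X_k (f' j)]].

Inductive generated_subring (G : F -> Prop) : F -> Prop :=
| generated_ground s : generated_subring G (ground s)
| generated_gen g : G g -> generated_subring G g
| generated_sub u v : generated_subring G u -> generated_subring G v ->
    generated_subring G (u - v)
| generated_mul u v : generated_subring G u -> generated_subring G v ->
    generated_subring G (u * v).

(* mu is the given choice of mutations on the collection C. *)
Definition is_LP_algebra (A : F -> Prop) (C : LPseed -> Prop) : Prop :=
  [/\ is_UFD S,
      forall t, C t -> is_LPseed t,
      exists mu : LPseed -> 'I_n -> LPseed,
        (forall t i, C t -> C (mu t i) /\ LP_mutation t i (mu t i)) /\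
        (forall t t', C t -> C t' ->
           clos_refl_sym_trans LPseed
             (fun t1 t2 => C t1 /\ exists i, t2 = mu t1 i) t t')
    & forall u, A u <->
        generated_subring
          (fun g => exists t, C t /\ exists i, g = cluster t i) u].

End LPAlgebras.

(* Cluster algebras of geometric type, with m = n + r: the frozen       *)
(* variables x_{n+1}, ..., x_m are the generators of the Laurent        *)
(* polynomial ring S = laurent int r.                                   *)

Section ClusterAlgebras.
Variables (n r : nat).

Local Notation S := (laurent int r).
Local Notation F := {fraction {mpoly {fraction S}[n]}}.

Record CAseed := MkCAseed {
  ca_cluster : {ffun 'I_n -> F};
  ca_matrix : 'M[int]_(n + r, n) }.

Definition skew_symmetrizable (B : 'M[int]_n) : Prop :=
  exists d : 'rV[rat]_n, (forall i, 0 < d 0 i) /\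
    let DB := diag_mx d *m map_mx intr B in DB^T = - DB.

Definition is_CAseed (t : CAseed) : Prop :=
  transcendence_basis (ca_cluster t) /\
  skew_symmetrizable (usubmx (ca_matrix t)).

(* A zero column has gcd 0, hence is not primitive. *)
Definition primitive (B : 'M[int]_(n + r, n)) : Prop :=
  forall j, \big[gcdn/0%N]_(i < n + r) `|B i j|%N = 1%N.

(* Full rank means rank n, as n <= n + r. *)
Definition full_rank (B : 'M[int]_(n + r, n)) : Prop :=
  \rank (map_mx intr B : 'M[rat]_(n + r, n)) = n.

Definition ext_var (k : 'I_(n + r)) : {mpoly S[n]} :=
  match split k with
  | inl i => 'X_i
  | inr l => (laurent_var int l)%:MP
  end.

Definition exchange_poly (B : 'M[int]_(n + r, n)) (j : 'I_n) : {mpoly S[n]} :=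
  \prod_(k < n + r | 0 < B k j) ext_var k ^+ `|B k j|%N +
  \prod_(k < n + r | B k j < 0) ext_var k ^+ `|B k j|%N.

Definition LPseed_of (t : CAseed) : LPseed S n :=
  MkLPseed (ca_cluster t) [ffun j => exchange_poly (ca_matrix t) j].

Definition mutate_matrix (B : 'M[int]_(n + r, n)) (i : 'I_n) :
    'M[int]_(n + r, n) :=
  let i' := lshift r i in
  \matrix_(k, j)
    if (k == i') || (j == i) then - B k j
    else B k j + ((`|B k i| * B i' j + B k i * `|B i' j|) %/ 2)%Z.

Definition CA_mutation (t : CAseed) (i : 'I_n) : CAseed :=
  let x := ca_cluster t in
  MkCAseed
    [ffun j => if j == i
               then mmap (@ground S n) x (exchange_poly (ca_matrix t) i) / x i
               else x j]
    (mutate_matrix (ca_matrix t) i).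

Inductive CA_reachable (t0 : CAseed) : CAseed -> Prop :=
| reach_init : CA_reachable t0 t0
| reach_step t i : CA_reachable t0 t -> CA_reachable t0 (CA_mutation t i).

Definition cluster_algebra (t0 : CAseed) : F -> Prop :=
  @generated_subring S n
    (fun g => exists t, CA_reachable t0 t /\ exists i, g = ca_cluster t i).

Definition CA_LPseeds (t0 : CAseed) (t : LPseed S n) : Prop :=
  exists2 t1 : CAseed, CA_reachable t0 t1 & t = LPseed_of t1.

End ClusterAlgebras.

(* Main.v *)
From HB Require Import structures.
From Stdlib Require Import Relation_Operators.
Require Import Defs.
From mathcomp Require Import all_boot all_order all_algebra.
From mathcomp Require Import boolp ring lra zify.
From mathcomp Require Import mpoly.

Set Implicit Arguments.
Unset Strict Implicit.
Unset Printing Implicit Defensive.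

Import Order.TTheory GRing.Theory Num.Theory.
Local Open Scope ring_scope.

(** For a primitive seed of full rank the exchange Laurent polynomial of [F_i] is
    [F_i] itself, so that the mutation rule for LP seeds has no freedom left
    beyond monomials, and it can be compared with matrix mutation.

    Everything rests on two facts about the binomials [F_j], both read off
    from Newton polytopes. The width of a Newton polytope in a given direction
    is additive under multiplication ([width_mul]). Hence a binomial whose two
    exponents differ by a primitive vector has no proper factorization apart
    from monomials ([exchange_irreducible]), and, in the Laurent ring, [F_j]
    divides no monomial, and divides [F_i] only if the columns [i] and [j] are
    parallel ([ldvd_exchange_monomial], [ldvd_exchange]). Full rank excludes
    the latter for [j <> i].

    Consequently all exponents [a_k] of the hat monomial vanish
    ([hat_exponent_exchange]): if [F_i] is free of [x_j], substituting in it
    does nothing; otherwise one of its two terms becomes a multiple of [F_j]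
    and the other one stays a monomial. For the same reason [F_i] at [x_j = 0] is
    a monomial, which has no factor to remove, and the LP rule for [F_j'] is a
    monomial substitution into a binomial. The ratio of the two terms of the
    result is given by column [j] of the mutated matrix
    ([mutation_monomial]).

    These hypotheses persist. Skew-symmetrizability, primitivity (in the form of
    a Bezout relation for each column) and linear independence of the columns
    are preserved by matrix mutation ([skew_mutate], [unimodular_mutate],
    [free_mutate]), and clusters remain transcendence bases, because
    [x_i -> F_i / x_i] is an involution ([exchange_transcendence_basis]).

    Two points concern the definition of an LP algebra only. The coefficient
    ring, Laurent polynomials over the integers, is a unique factorization
    domain by Gauss's lemma and localization ([laurent_factorial]). And mutation has
    to be a function of the LP seed, although different matrices can give the
    same exchange polynomials: they then agree up to signs of columns, and
    these signs are constant on the connected components of the exchange matrix,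
    so that they do not affect mutation ([LPseed_of_mutation]). *)

(** * Unique factorization through prime elements *)

Definition prime_elt (R : idomainType) (p : R) : Prop :=
  [/\ p != 0, p \isn't a GRing.unit
    & forall a b, rdvd p (a * b) -> rdvd p a \/ rdvd p b].

Definition prime_product (R : idomainType) (a : R) : Prop :=
  exists (u : R) (s : seq R),
    [/\ u \is a GRing.unit, forall p, p \in s -> prime_elt p
      & a = u * \prod_(p <- s) p].

(** For domains this is equivalent to unique factorization; unlike the usual
    definition, it passes to polynomials and to localizations at once. *)
Definition prime_factorial (R : idomainType) : Prop :=
  forall a : R, a != 0 -> prime_product a.

Section PrimeElements.
Variable R : idomainType.
Implicit Types (a b p q u : R) (s t : seq R).

Lemma rdvd_mulr p a b : rdvd p a -> rdvd p (a * b).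
Proof. by case=> c ->; exists (c * b); rewrite mulrAC. Qed.

Lemma rdvd_mull p a b : rdvd p b -> rdvd p (a * b).
Proof. by rewrite mulrC; apply: rdvd_mulr. Qed.

Lemma rdvd_refl p : rdvd p p. Proof. by exists 1; rewrite mul1r. Qed.

Lemma rdvd_unit p u : rdvd p u -> u \is a GRing.unit -> p \is a GRing.unit.
Proof. by case=> c ->; rewrite unitrM => /andP[]. Qed.

Lemma prime_dvd_prod p s :
  prime_elt p -> rdvd p (\prod_(q <- s) q) -> exists2 q, q \in s & rdvd p q.
Proof.
move=> pP; elim: s => [|q s IHs].
  rewrite big_nil => /rdvd_unit; rewrite unitr1 => /(_ isT) pU.
  by case: pP => _ /negP.
rewrite big_cons; case: pP (pP) => _ _ pM pP /pM[pq|/IHs[q' q's pq']].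
  by exists q; rewrite // mem_head.
by exists q' => //; rewrite in_cons q's orbT.
Qed.

Lemma prime_irreducible p : prime_elt p -> irreducible p.
Proof.
case=> p0 pU pM; split=> // a b pE.
have [|[c aE]|[c bE]] := pM a b; first by rewrite -pE; apply: rdvd_refl.
  right; apply/unitrPr; exists c; apply: (mulIf p0).
  by rewrite mul1r -mulrA -aE mulrC -pE.
left; apply/unitrPr; exists c; apply: (mulIf p0).
by rewrite mul1r -mulrA -bE -pE.
Qed.

Lemma irreducible_dvd p q :
  p \isn't a GRing.unit -> irreducible q -> rdvd p q -> associated p q.
Proof.
move=> pU [qU qI] [c qE]; case: (qI _ _ qE) => [cU|]; last by rewrite (negPf pU).
by exists c^-1; rewrite ?unitrV // qE mulKr.
Qed.

Lemma prime_associated p q : associated p q -> prime_elt p -> prime_elt q.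
Proof.
case=> u uU pE [p0 pU pM].
have dvdE a : rdvd q a <-> rdvd p a.
  rewrite pE; split=> -[c ->]; last by exists (c * u); rewrite mulrA.
  by exists (c * u^-1); rewrite -mulrA mulKr.
split.
- by apply: contraNneq p0 => q0; rewrite pE q0 mulr0.
- by apply: contra pU => qU; rewrite pE unitrM uU.
- by move=> a b /dvdE /pM[] /dvdE; [left|right].
Qed.

Lemma irreducible_neq0 q : irreducible q -> q != 0.
Proof.
move=> [qU qI]; apply: contraNneq qU => q0.
by have [] := qI 0 0; rewrite ?mulr0 // q0.
Qed.

Lemma factorial_irreducible_prime q :
  prime_factorial R -> irreducible q -> prime_elt q.
Proof.
move=> fR qI; have [u [[|p s] [uU sP qE]]] := fR q (irreducible_neq0 qI).
  by case: qI => /negP; rewrite qE big_nil mulr1.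
have pP : prime_elt p by apply: sP; rewrite mem_head.
apply: prime_associated pP; apply: irreducible_dvd => //.
  by case: (sP p (mem_head _ _)).
by rewrite qE big_cons mulrCA; apply/rdvd_mulr/rdvd_refl.
Qed.

(** Only the products are assumed associated, not equal: cancelling a pair of
    associated factors leaves a unit behind. *)
Lemma associated_prod_perm s t :
    (forall q, q \in s -> prime_elt q) -> (forall q, q \in t -> irreducible q) ->
    associated (\prod_(q <- s) q) (\prod_(q <- t) q) ->
  exists t', [/\ perm_eq t t', size s = size t'
    & forall k, (k < size s)%N -> associated s`_k t'`_k].
Proof.
elim: s t => [|p s IHs] t sP tI.
  case: t tI => [|q t] tI; first by exists [::].
  rewrite big_nil big_cons => -[u uU /esym qU]; case: (tI q (mem_head _ _)).
  move=> /negP[]; apply: (@rdvd_unit _ 1); last exact: unitr1.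
  by rewrite -qU; apply/rdvd_mull/rdvd_mulr/rdvd_refl.
rewrite big_cons => -[u uU stE].
have pP : prime_elt p by apply: sP; rewrite mem_head.
have [|q qt pq] := prime_dvd_prod (s := t) pP.
  suff -> : \prod_(q <- t) q = p * (u^-1 * \prod_(j <- s) j).
    exact/rdvd_mulr/rdvd_refl.
  by rewrite mulrCA stE mulKr.
have {pq} [v vU pE] : associated p q.
  by apply: irreducible_dvd (tI _ qt) pq; case: pP.
have [| | |t' [tt' st' at']] := IHs (rem q t).
- by move=> x xs; apply: sP; rewrite in_cons xs orbT.
- by move=> x xt; apply/tI/(mem_rem xt).
- exists (v^-1 * u); first by rewrite unitrM unitrV vU.
  have q0 := irreducible_neq0 (tI _ qt).
  apply: (mulfI q0); rewrite -[LHS](mulKr vU) [v * _]mulrA -pE stE.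
  rewrite (perm_big _ (perm_to_rem qt)) big_cons.
  by rewrite mulrCA [u * _]mulrCA [RHS]mulrCA !mulrA.
exists (q :: t'); split.
- by rewrite (perm_trans (perm_to_rem qt)) // perm_cons.
- by rewrite /= st'.
- by case=> [_|k]; [exists v | apply: at'].
Qed.

Lemma factorial_UFD : prime_factorial R -> is_UFD R.
Proof.
move=> fR; split=> [a a0 aU|s t sI tI stE].
  have [u [[|p s] [uU sP aE]]] := fR a a0.
    by rewrite aE big_nil mulr1 uU in aU.
  exists (u * p :: s); last by rewrite big_cons -mulrA aE big_cons.
  move=> q; rewrite in_cons => /orP[/eqP->|qs]; apply: prime_irreducible.
    apply: (@prime_associated p); last by apply: sP; rewrite mem_head.
    by exists u^-1; rewrite ?unitrV // mulKr.
  by apply: sP; rewrite in_cons qs orbT.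
apply: associated_prod_perm => // [q /sI|]; first exact: factorial_irreducible_prime.
by rewrite stE; exists 1; rewrite ?unitr1 ?mul1r.
Qed.

Lemma prime_productM a b :
  prime_product a -> prime_product b -> prime_product (a * b).
Proof.
move=> [u [s [uU sP ->]]] [v [t [vU tP ->]]]; exists (u * v), (s ++ t); split.
- by rewrite unitrM uU.
- by move=> p; rewrite mem_cat => /orP[/sP|/tP].
- by rewrite big_cat /= mulrACA.
Qed.

Lemma prime_product_prime p : prime_elt p -> prime_product p.
Proof.
move=> pP; exists 1, [:: p]; split; rewrite ?unitr1 ?big_seq1 ?mul1r // => q.
by rewrite inE => /eqP->.
Qed.

Lemma prime_product_unit u : u \is a GRing.unit -> prime_product u.
Proof. by move=> uU; exists u, [::]; split; rewrite ?big_nil ?mulr1. Qed.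

End PrimeElements.

Lemma factorial_transfer (A B : idomainType) (f : {rmorphism A -> B})
    (g : {rmorphism B -> A}) :
  cancel f g -> cancel g f -> prime_factorial B -> prime_factorial A.
Proof.
move=> fK gK fB a a0.
have unitE b : (g b \is a GRing.unit) = (b \is a GRing.unit).
  by apply/idP/idP => [/(rmorph_unit f)|/(rmorph_unit g)//]; rewrite gK.
have dvdE b c : rdvd (g b) c <-> rdvd b (f c).
  split=> [[d ->]|[d dE]]; first by exists (f d); rewrite rmorphM gK.
  by exists (g d); rewrite -rmorphM -dE fK.
have [|u [s [uU sP aE]]] := fB (f a).
  by apply: contra_neq a0 => fa0; rewrite -(fK a) fa0 rmorph0.
exists (g u), (map g s); split; first by rewrite unitE.
- move=> _ /mapP[p /sP[p0 pU pM] ->]; split; rewrite ?unitE //.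
    by apply: contra_neq p0 => gp0; rewrite -(gK p) gp0 rmorph0.
  by move=> b c /dvdE; rewrite rmorphM => /pM[] /dvdE; [left|right].
- by rewrite -(fK a) aE rmorphM rmorph_prod big_map.
Qed.

Lemma int_factorial : prime_factorial int.
Proof.
have natP (p : nat) : prime p -> prime_elt (p%:Z).
  move=> pP; split=> [||a b].
  - by rewrite eqz_nat -lt0n prime_gt0.
  - by rewrite qualifE /= orbF eqz_nat neq_ltn prime_gt1 ?orbT.
  - have dvdE (c : int) : rdvd p%:Z c <-> (p %| `|c|)%N.
      split=> [[d ->]|]; first by rewrite abszM dvdn_mull.
      by move=> /(@dvdzP p%:Z)[d dE]; exists d.
    by rewrite !dvdE abszM Euclid_dvdM // => /orP.
move=> a a0; rewrite [a]intEsign; apply: prime_productM.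
  apply: prime_product_unit; apply: unitrX; exact: unitrN1.
have: (0 < `|a|)%N by rewrite absz_gt0.
move: (absz a) => k k0; rewrite (prod_prime_decomp k0) prime_decompE big_map.
rewrite (big_morph Posz PoszM (erefl 1%:Z)) big_seq.
apply: big_ind => [||p /=].
- exact/prime_product_unit/unitr1.
- exact: prime_productM.
- rewrite mem_primes => /andP[/natP pP _].
  elim: (logn p k) => [|e IHe]; first exact/prime_product_unit/unitr1.
  by rewrite expnS PoszM; apply: prime_productM => //; apply: prime_product_prime.
Qed.

(** * Gauss's lemma: polynomials and Laurent polynomials *)

Section PolyFactorial.
Variable R : idomainType.
Implicit Types (f g h : {poly R}) (c p : R).

Lemma rdvd_polyC p f : rdvd p%:P f <-> exists g, f = p *: g.
Proof.
by split=> -[g ->]; exists g; rewrite mulrC mul_polyC.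
Qed.

(** If [p] divides [(f 'X + c) (g 'X + d)], it divides the constant term
    [c d], hence [c] or [d], and that constant can be dropped from its factor. *)
Lemma polyC_prime p : prime_elt p -> prime_elt p%:P.
Proof.
case=> p0 pU pM; split=> [||f g]; first by rewrite polyC_eq0.
  by rewrite poly_unitE size_polyC p0 coefC.
have dvdC c : rdvd p c -> rdvd p%:P c%:P by case=> d ->; exists d%:P; rewrite polyCM.
have dvdX h : rdvd p%:P (h * 'X) -> rdvd p%:P h.
  move=> /rdvd_polyC[k kE]; apply/rdvd_polyC.
  exists (\poly_(i < size k) k`_i.+1); apply/polyP=> i.
  have := congr1 (fun u : {poly R} => u`_i.+1) kE; rewrite coefMX !coefZ /= => ->.
  by rewrite coef_poly; case: ltnP => // ik; rewrite nth_default ?(leqW ik).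
have dvdD h k : rdvd p%:P h -> rdvd p%:P k -> rdvd p%:P (h + k).
  by case=> u -> [v ->]; exists (u + v); rewrite mulrDl.
have dvdDl h k : rdvd p%:P (h + k) -> rdvd p%:P k -> rdvd p%:P h.
  move=> [u uE] [v vE]; exists (u - v); rewrite mulrBl -uE -vE; ring.
elim/poly_ind: f g => [|f c IHf] g; first by left; exists 0; rewrite mul0r.
elim/poly_ind: g => [|g d IHg] fgE; first by right; exists 0; rewrite mul0r.
have: rdvd p (c * d).
  have [k /(congr1 (fun u : {poly R} => u`_0))] := fgE.
  rewrite !coef0M !coefD !coefMX !coefC /= !add0r => ->.
  by exists k`_0.
case/pM => [pc|pd].
- have [] := IHf (g * 'X + d%:P).
  + apply: dvdX; apply: (dvdDl _ (c%:P * (g * 'X + d%:P))).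
      by move: fgE; congr rdvd; ring.
    exact/rdvd_mulr/dvdC.
  + by left; apply: dvdD; [apply: rdvd_mulr | apply: dvdC].
  + by right.
- have [] := IHg.
  + apply: dvdX; apply: (dvdDl _ ((f * 'X + c%:P) * d%:P)).
      by move: fgE; congr rdvd; ring.
    exact/rdvd_mull/dvdC.
  + by left.
  + by right; apply: dvdD; [apply: rdvd_mulr | apply: dvdC].
Qed.

Hypothesis factorialR : prime_factorial R.

(** Gauss's lemma without contents: each prime factor of the constant is
    moved to one of the two polynomials. *)
Lemma scale_eq_mul c f g h : c != 0 -> c *: f = g * h ->
  exists c1 c2 g' h', [/\ c1 * c2 = c, g = c1 *: g', h = c2 *: h' & f = g' * h'].
Proof.
move=> c0; have [u [s [uU sP cE]]] := factorialR c0.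
rewrite {}cE {c c0}; elim: s sP g h => [|p s IHs] sP g h.
  rewrite big_nil mulr1 => fE; exists u, 1, (u^-1 *: g), h.
  rewrite mulr1 scale1r scalerA divrr // scale1r -scalerAl -fE scalerA.
  by rewrite mulVr // scale1r.
have pP : prime_elt p by apply: sP; rewrite mem_head.
have {IHs} IHs := IHs (fun q qs => sP q (mem_behead (s := p :: s) qs)).
rewrite big_cons mulrCA => fE.
have: rdvd p%:P (g * h) by apply/rdvd_polyC; rewrite -fE -scalerA; eexists.
have p0 : p != 0 by case: pP.
have scaleI f1 f2 : p *: f1 = p *: f2 -> f1 = f2.
  by move=> /eqP; rewrite -!mul_polyC => /eqP /mulfI; apply; rewrite polyC_eq0.
have [_ _ /(_ g h)pM] := polyC_prime pP.
case/pM => /rdvd_polyC[k kE].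
- have [|c1 [c2 [g' [h' [cE gE hE fE']]]]] := IHs k h.
    by apply: scaleI; rewrite scalerA fE kE scalerAl.
  by exists (p * c1), c2, g', h'; rewrite -mulrA cE kE gE scalerA.
- have [|c1 [c2 [g' [h' [cE gE hE fE']]]]] := IHs g k.
    by apply: scaleI; rewrite scalerA fE kE scalerAr.
  by exists c1, (p * c2), g', h'; rewrite [c1 * _]mulrCA cE kE hE scalerA.
Qed.

Definition primitive_poly f := forall c g, f = c *: g -> c \is a GRing.unit.

(** The relation [%|] is divisibility over the fraction field; for a primitive
    divisor the denominators can be removed. *)
Lemma primitive_dvdp f g : primitive_poly f -> g != 0 -> (f %| g)%R -> rdvd f g.
Proof.
move=> fP g0 /Pdiv.WeakIdomain.dvdpP[[c k] /= c0].
case/(scale_eq_mul c0) => c1 [c2 [k' [f' [_ _ fE ->]]]].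
exists (c2^-1 *: k'); have c2U := fP _ _ fE.
by rewrite fE -scalerAr -scalerAl scalerA divrr ?scale1r.
Qed.

(** Such an [f] is irreducible over the fraction field, where irreducible
    polynomials are prime; divisibility by [f] descends to [R]. *)
Lemma primitive_prime f : primitive_poly f -> (1 < size f)%N ->
    (forall g h, f = g * h -> (size g <= 1)%N \/ (size h <= 1)%N) ->
  prime_elt f.
Proof.
move=> fP f1 fI.
have f0 : f != 0 by rewrite -size_poly_gt0 ltnW.
have irrf g : size g != 1 -> (g %| f)%R -> (f %| g)%R.
  move=> g1 /Pdiv.WeakIdomain.dvdpP[[c k] /= c0 cE].
  have [c1 [c2 [k' [g' [c12 kE gE fE]]]]] := scale_eq_mul c0 cE.
  have c20 : c2 != 0 by apply: contra_eq_neq c12 => ->; rewrite mulr0 eq_sym.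
  have [k1|g'1] := fI _ _ fE.
    have k0 : k' != 0 by apply: contraNneq f0 => k'0; rewrite fE k'0 mul0r.
    apply/Pdiv.WeakIdomain.dvdpP; exists (k'`_0, c2%:P) => /=.
      by apply: contraNneq k0 => k'0; rewrite (size1_polyC k1) k'0.
    by rewrite gE fE (size1_polyC k1) coefC /= !mul_polyC !scalerA mulrC.
  have g0 : g' != 0 by apply: contraNneq f0 => g'0; rewrite fE g'0 mulr0.
  case/eqP: g1; rewrite gE size_scale //; apply/eqP.
  by rewrite eqn_leq g'1 size_poly_gt0.
split=> // [|g h fgh]; first by rewrite poly_unitE gtn_eqF.
have [->|g0] := eqVneq g 0; first by left; exists 0; rewrite mul0r.
have [->|h0] := eqVneq h 0; first by right; exists 0; rewrite mul0r.
have fgh' : (f %| g * h)%R by case: fgh => k ->; rewrite Pdiv.Idomain.dvdp_mull.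
have [/eqP cfg|cfg] := boolP (size (gcdp f g) == 1%N).
  right; apply: primitive_dvdp => //.
  by rewrite Pdiv.Idomain.Gauss_dvdpr // /coprimep cfg in fgh'.
left; apply: primitive_dvdp => //.
exact: Pdiv.Idomain.dvdp_trans (irrf _ cfg (dvdp_gcdl f g)) (dvdp_gcdr f g).
Qed.

(** By induction on the degree, then on the number of prime factors of the
    leading coefficient: either a prime constant divides [f] and can be removed
    from both, or [f] is primitive, and splits into factors of smaller degree or
    is prime itself. *)
Lemma poly_factorial : prime_factorial {poly R}.
Proof.
move=> f f0; move: {2}(size f) (leqnn (size f)) => n.
elim: n f f0 => [|n IHn] f f0; first by rewrite leqn0 size_poly_eq0 (negPf f0).
move=> fn.
have primP g : g != 0 -> (size g <= n.+1)%N ->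
    ~ (exists2 p, prime_elt p & rdvd p%:P g) -> prime_product g.
  move=> g0 gn gP.
  have gprim : primitive_poly g.
    move=> c h gE; have c0 : c != 0.
      by apply: contraNneq g0 => c0; rewrite gE c0 scale0r.
    have [u [[|p s] [uU sP cE]]] := factorialR c0.
      by rewrite cE big_nil mulr1.
    case: gP; exists p; first by apply: sP; rewrite mem_head.
    apply/rdvd_polyC; exists ((u * \prod_(q <- s) q) *: h).
    by rewrite gE cE big_cons scalerA mulrCA.
  have [g1|g1] := leqP (size g) 1.
    apply: prime_product_unit.
    rewrite poly_unitE [size g == _]eqn_leq g1 size_poly_gt0 g0.
    by apply: (gprim _ 1); rewrite -mul_polyC mulr1 -size1_polyC.
  have [[h [k [gE h1 k1]]]|gI] :=
      pselect (exists h k, [/\ g = h * k, (1 < size h)%N & (1 < size k)%N]).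
    have h0 : h != 0 by rewrite -size_poly_gt0 ltnW.
    have k0 : k != 0 by rewrite -size_poly_gt0 ltnW.
    move: gn; rewrite gE size_mul // => gn.
    by apply: prime_productM; apply: IHn => //; lia.
  apply/prime_product_prime/primitive_prime => // h k gE.
  have [|h1] := leqP (size h) 1; first by left.
  have [|k1] := leqP (size k) 1; first by right.
  by case: gI; exists h, k.
have [u [s [uU sP]]]: prime_product (lead_coef f).
  by apply: factorialR; rewrite lead_coef_eq0.
move: {2}(size s) (erefl (size s)) => k.
elim: k s u f uU sP f0 fn => [|k IHk] s u f uU sP f0 fn sk lfE.
all: have [[p pP pf]|fP] := pselect (exists2 p, prime_elt p & rdvd p%:P f).
all: try exact: primP.
all: have /rdvd_polyC[g fE] := pf; move: lfE; rewrite fE lead_coefZ => lfE.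
  move: lfE; rewrite (size0nil sk) big_nil mulr1 => puE.
  by case: pP => _ /negP[]; move: uU; rewrite -puE unitrM => /andP[].
have p0 : p != 0 by case: pP.
have [_ _ pM] := pP.
have /pM[pu|/(prime_dvd_prod pP)[q qs pq]]: rdvd p (u * \prod_(q <- s) q).
- by rewrite -lfE; apply/rdvd_mulr/rdvd_refl.
- by case: pP => _ /negP[]; apply: rdvd_unit pu uU.
have [|v vU pE] := irreducible_dvd _ (prime_irreducible (sP q qs)) pq.
  by case: pP.
rewrite -mul_polyC; apply: prime_productM.
  exact/prime_product_prime/polyC_prime.
apply: (IHk (rem q s) (v^-1 * u)).
- by rewrite unitrM unitrV vU.
- by move=> q' /mem_rem/sP.
- by apply: contraNneq f0 => g0; rewrite fE g0 scaler0.
- by rewrite fE size_scale in fn.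
- by rewrite size_rem // sk.
- apply: (mulfI p0); rewrite lfE (perm_big _ (perm_to_rem qs)) big_cons pE.
  by rewrite -!mulrA [q * (v^-1 * _)]mulrCA mulVKr // mulrCA.
Qed.

End PolyFactorial.

Lemma mpoly_rmorph_ext (n : nat) (R : comNzRingType) (T : comNzRingType)
    (f g : {rmorphism {mpoly R[n]} -> T}) :
    (forall c, f c%:MP = g c%:MP) -> (forall i, f 'X_i = g 'X_i) -> f =1 g.
Proof.
move=> fgC fgX p; rewrite (mpolyE p) !rmorph_sum; apply: eq_bigr => m _.
rewrite -mul_mpolyC !rmorphM fgC mpolyXE_id !rmorph_prod; congr (_ * _).
by apply: eq_bigr => i _; rewrite !rmorphXn fgX.
Qed.

Lemma mpoly0_factorial (R : idomainType) :
  prime_factorial R -> prime_factorial {mpoly R[0]}.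
Proof.
move=> fR; have mnm_eq0 (m : 'X_{1..0}) : m = 0%MM by apply/mnmP=> -[].
apply: (@factorial_transfer _ _ (mcoeff 0%MM) (@mpolyC 0 R)) fR => [p|c].
  by apply/mpolyP=> m; rewrite (mnm_eq0 m) mcoeffC eqxx mulr1.
by rewrite /= mcoeffC eqxx mulr1.
Qed.

Section MpolyFactorial.
Local Notation widen := (widen_ord (leqnSn _)).
Variables (R : idomainType) (n : nat).

Lemma muniX_widen (i : 'I_n) : muni ('X_(widen i) : {mpoly R[n.+1]}) = ('X_i)%:P.
Proof.
rewrite muniE msuppX big_seq1 mcoeffX eqxx scale1r mnm1E.
have /negPf-> : widen i != ord_max by rewrite -val_eqE /= neq_ltn ltn_ord.
rewrite expr0 alg_polyC; congr ('X_[_])%:P; apply/mnmP=> j.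
by rewrite mnmE !mnm1E -val_eqE.
Qed.

Lemma muniX_max : muni ('X_ord_max : {mpoly R[n.+1]}) = 'X.
Proof.
rewrite muniE msuppX big_seq1 mcoeffX eqxx scale1r mnm1E eqxx expr1.
rewrite (_ : [multinom _ | _ < n] = 0%MM) ?mpolyX0 ?scale1r //.
by apply/mnmP=> j; rewrite mnmE mnm1E mnm0E -val_eqE /= gtn_eqF ?ltn_ord.
Qed.

Lemma mwidenXU (i : 'I_n) : mwiden ('X_i : {mpoly R[n]}) = 'X_(widen i).
Proof. by rewrite mwidenX mnmwiden1. Qed.

Lemma mpolyS_factorial :
  prime_factorial {mpoly R[n]} -> prime_factorial {mpoly R[n.+1]}.
Proof.
move=> fR; pose f : {rmorphism {mpoly R[n.+1]} -> {poly {mpoly R[n]}}} := @muni n R.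
pose g : {rmorphism {poly {mpoly R[n]}} -> {mpoly R[n.+1]}} :=
  horner_morph (fun x => mulrC 'X_ord_max (mwiden x)).
have fC c : f c%:MP = c%:MP%:P by apply: muniC.
have fXw i : f 'X_(widen i) = ('X_i)%:P by apply: muniX_widen.
have fX : f 'X_ord_max = 'X by apply: muniX_max.
have gC p : g p%:P = mwiden p by apply: horner_morphC.
have gX : g 'X = 'X_ord_max by apply: horner_morphX.
have fW : f \o @mwiden n R =1 polyC.
  apply: mpoly_rmorph_ext => [c|i] /=; first by rewrite mwidenC fC.
  by rewrite mwidenXU fXw.
apply: (@factorial_transfer _ _ f g) (poly_factorial fR).
- apply: (mpoly_rmorph_ext (f := g \o f) (g := idfun)) => [c|i] /=.
    by rewrite fC gC mwidenC.
  have [j ->|->] := unliftP ord_max i.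
    have -> : lift ord_max j = widen j.
      by apply: val_inj; rewrite /= /bump leqNgt ltn_ord.
    by rewrite fXw gC mwidenXU.
  by rewrite fX gX.
- elim/poly_ind => [|p c IHp]; first by rewrite !rmorph0.
  by rewrite 2!rmorphD 2!rmorphM IHp gX gC fX [f _](fW c).
Qed.

End MpolyFactorial.

Lemma mpoly_factorial (R : idomainType) (n : nat) :
  prime_factorial R -> prime_factorial {mpoly R[n]}.
Proof.
move=> fR; elim: n => [|n]; first exact: mpoly0_factorial.
exact: mpolyS_factorial.
Qed.

Section LaurentFactorial.
Variables (R : idomainType) (n : nat).
Local Notation L := (laurent R n).

Fact lpoly_subproof (p : {mpoly R[n]}) : p%:F \in @laurent_pred R n.
Proof. by apply/asboolP; exists p, 0%MM; rewrite mpolyX0 tofrac1 divr1. Qed.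

Definition lpoly (p : {mpoly R[n]}) : L := Laurent (lpoly_subproof p).

Fact lpoly_is_zmod_morphism : zmod_morphism lpoly.
Proof. by move=> p q; apply: val_inj; apply: tofracB. Qed.

Fact lpoly_is_monoid_morphism : monoid_morphism lpoly.
Proof.
by split=> [|p q]; apply: val_inj; [apply: tofrac1 | apply: tofracM].
Qed.

HB.instance Definition _ :=
  GRing.isZmodMorphism.Build {mpoly R[n]} L lpoly lpoly_is_zmod_morphism.
HB.instance Definition _ :=
  GRing.isMonoidMorphism.Build {mpoly R[n]} L lpoly lpoly_is_monoid_morphism.

Lemma lpoly_inj : injective lpoly.
Proof. by move=> p q /(congr1 val)/= /eqP; rewrite tofrac_eq => /eqP. Qed.

Lemma lpolyX (i : 'I_n) : lpoly 'X_i = laurent_var R i.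
Proof. exact: val_inj. Qed.

Lemma laurent_var_unit (i : 'I_n) : laurent_var R i \is a GRing.unit.
Proof.
have X0 : ('X_i : {mpoly R[n]})%:F != 0 by rewrite tofrac_eq0 -msupp_eq0 msuppX.
apply/andP; split=> //=; apply/asboolP.
by exists 1, U_(i)%MM; rewrite tofrac1 mul1r.
Qed.

Lemma lpolyXm_unit a : lpoly 'X_[a] \is a GRing.unit.
Proof.
rewrite mpolyXE_id rmorph_prod; apply: (big_ind (fun x => x \is a GRing.unit)).
- exact: unitr1.
- by move=> x y xU yU; rewrite unitrM xU.
- by move=> i _; rewrite rmorphXn unitrX //= lpolyX laurent_var_unit.
Qed.

Lemma laurent_clear (u : L) : exists p a, u * lpoly 'X_[a] = lpoly p.
Proof.
have /asboolP[p [a uE]] := valP u; exists p, a; apply: val_inj.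
have X0 : ('X_[a] : {mpoly R[n]})%:F != 0 by rewrite tofrac_eq0 -msupp_eq0 msuppX.
by change (val u * ('X_[a])%:F = p%:F); rewrite uE divfK.
Qed.

(** A prime either divides a monomial and becomes invertible, or stays prime. *)
Lemma lpoly_prime p :
  prime_elt p -> lpoly p \is a GRing.unit \/ prime_elt (lpoly p).
Proof.
case=> p0 pU pM; have [lpU|lpU] := boolP (lpoly p \is a GRing.unit); [by left|right].
have pX a : ~ rdvd p 'X_[a].
  case=> c /(congr1 lpoly) cE; case/negP: lpU.
  by apply: rdvd_unit (lpolyXm_unit a); exists (lpoly c); rewrite -rmorphM.
have dvdE u q a : u * lpoly 'X_[a] = lpoly q -> rdvd (lpoly p) u -> rdvd p q.
  move=> uE [v vE]; have [w [b wE]] := laurent_clear v.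
  have: rdvd p (q * 'X_[b]).
    exists (w * 'X_[a]); apply: lpoly_inj.
    by rewrite !rmorphM /= -uE vE -wE; ring.
  by case/pM => // /pX.
split=> // [|u v puv].
  by apply: contra_neq p0 => lp0; apply: lpoly_inj; rewrite lp0 rmorph0.
have [q [a uE]] := laurent_clear u; have [t [b vE]] := laurent_clear v.
have dvdL w k c : w * lpoly 'X_[c] = lpoly k -> rdvd p k -> rdvd (lpoly p) w.
  move=> wE [d dE]; exists (lpoly d * (lpoly 'X_[c])^-1).
  by rewrite mulrAC -rmorphM -dE /= -wE mulrK ?lpolyXm_unit.
have /(dvdE _ (q * t) (a + b)%MM) : rdvd (lpoly p) (u * v) by [].
rewrite mpolyXD !rmorphM /= -uE -vE => /(_ _)/pM[]; first by ring.
  by move/(dvdL _ _ _ uE); left.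
by move/(dvdL _ _ _ vE); right.
Qed.

Lemma laurent_factorial : prime_factorial R -> prime_factorial L.
Proof.
move=> /(@mpoly_factorial _ n) fP u u0; have [p [a uE]] := laurent_clear u.
have aU := lpolyXm_unit a.
have p0 : p != 0.
  apply: contraNneq u0 => p0; rewrite -(mulrK aU u) uE p0 rmorph0 mul0r //.
rewrite -(mulrK aU u) uE; apply: prime_productM; last first.
  by apply: prime_product_unit; rewrite unitrV.
have [v [s [vU sP ->]]] := fP p p0; rewrite rmorphM rmorph_prod.
apply: prime_productM; first exact/prime_product_unit/rmorph_unit.
rewrite big_seq; apply: big_ind => [||q /sP/lpoly_prime[]].
- exact/prime_product_unit/unitr1.
- exact: prime_productM.
- exact: prime_product_unit.
- exact: prime_product_prime.
Qed.

End LaurentFactorial.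

(** * Weights and Newton polytopes *)

Section Weights.
Variables (N : nat) (R : idomainType).
Implicit Types (w : 'I_N -> int) (m a b : 'X_{1..N}) (g h : {mpoly R[N]}).

Definition weight w m : int := \sum_k w k * (m k)%:Z.

Lemma weightD w a b : weight w (a + b) = weight w a + weight w b.
Proof.
by rewrite -big_split; apply: eq_bigr => k _; rewrite mnmDE PoszD mulrDr.
Qed.

Lemma weightN w m : weight (fun k => - w k) m = - weight w m.
Proof. by rewrite -sumrN; apply: eq_bigr => k _; rewrite mulNr. Qed.

Lemma max_weight w g : g != 0 -> exists2 a, a \in msupp g &
  forall m, m \in msupp g -> weight w m <= weight w a.
Proof.
rewrite -msupp_eq0; elim: (msupp g) => // m [|m' s] IHs _.
  by exists m; rewrite ?mem_head // => m0; rewrite inE => /eqP->.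
have [//|a as' amax] := IHs; have [ma|/ltW am] := leP (weight w m) (weight w a).
  exists a; first by rewrite in_cons as' orbT.
  by move=> b; rewrite in_cons => /orP[/eqP->|/amax].
exists m; first exact: mem_head.
move=> b; rewrite in_cons => /orP[/eqP->|/amax bwa] //; exact: le_trans bwa am.
Qed.

Definition weight_part w (d : int) g : {mpoly R[N]} :=
  \sum_(m <- msupp g | weight w m == d) g@_m *: 'X_[m].

Lemma mcoeff_weight_part w d g m :
  (weight_part w d g)@_m = if weight w m == d then g@_m else 0.
Proof.
rewrite /weight_part -big_filter raddf_sum /=.
under eq_bigr => b _ do rewrite mcoeffZ mcoeffX.
case: ifP => md; last first.
  rewrite big_seq big1 // => b; rewrite mem_filter => /andP[bd _].
  by case: eqP => [bm|]; [rewrite -bm bd in md | rewrite mulr0].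
have [mg|mg] := boolP (m \in msupp g); last first.
  rewrite big_seq big1 ?memN_msupp_eq0 // => b; rewrite mem_filter => /andP[_ bg].
  by case: eqP => [bm|]; [rewrite bm (negPf mg) in bg | rewrite mulr0].
rewrite (bigD1_seq m) ?filter_uniq ?msupp_uniq ?mem_filter ?md //= eqxx mulr1.
by rewrite big1 ?addr0 // => b /negPf->; rewrite mulr0.
Qed.

(** The parts of highest weight of two polynomials multiply without
    cancellation, so the highest weights add up. *)
Lemma max_weightM w g h a b :
    a \in msupp g -> (forall m, m \in msupp g -> weight w m <= weight w a) ->
    b \in msupp h -> (forall m, m \in msupp h -> weight w m <= weight w b) ->
  exists2 m, m \in msupp (g * h) & weight w m = weight w a + weight w b.
Proof.
move=> ag amax bh bmax; set d := weight w a; set e := weight w b.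
have part0 c k : c \in msupp k -> weight_part w (weight w c) k != 0.
  move=> ck; apply: contraTneq ck => /(congr1 (mcoeff c)).
  by rewrite mcoeff_weight_part eqxx mcoeff0 -mcoeff_eq0 => ->.
have := mulf_neq0 (part0 _ _ ag) (part0 _ _ bh); rewrite -msupp_eq0.
case mE : msupp => [//|m s] _.
have: m \in msupp (weight_part w d g * weight_part w e h) by rewrite mE mem_head.
move=> mgh; have wm : weight w m = d + e.
  have /allpairsP[[a1 b1] [/= a1g b1h ->]] := msuppM_le mgh.
  rewrite weightD; congr (_ + _); apply/eqP.
    by move: a1g; rewrite mcoeff_msupp mcoeff_weight_part; case: ifP; rewrite ?eqxx.
  by move: b1h; rewrite mcoeff_msupp mcoeff_weight_part; case: ifP; rewrite ?eqxx.
exists m => //; move: mgh; rewrite !mcoeff_msupp; congr (_ != _).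
rewrite !mcoeffM; apply: eq_bigr => k /eqP mk.
have {mk} wk : weight w k.1 + weight w k.2 = d + e by rewrite -weightD -mk.
rewrite !mcoeff_weight_part.
have over c (p : {mpoly R[N]})
    (cmax : forall m, m \in msupp p -> weight w m <= weight w c) m' :
    weight w c < weight w m' -> p@_m' = 0.
  by move=> cm; apply: memN_msupp_eq0; apply: contraTN cm => /cmax; rewrite leNgt.
case: (ltgtP (weight w k.1) d) => k1.
- rewrite (over _ _ bmax k.2) ?mulr0 //; first by case: ifP; rewrite mulr0.
  by rewrite -(ltrD2l (weight w k.1)) wk ltrD2r.
- by rewrite (over _ _ amax k.1) // !mul0r.
- by rewrite k1 in wk; rewrite (addrI _ wk) eqxx.
Qed.

(** The width of a Newton polytope in a direction is additive: its highest
    weights add up for [w] and for [- w]. Only the half of additivity that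
    bounds the factors is recorded, for arbitrary pairs of exponents. *)
Lemma width_mul w g h a a' b b' :
    a \in msupp g -> a' \in msupp g -> b \in msupp h -> b' \in msupp h ->
  exists m m', [/\ m \in msupp (g * h), m' \in msupp (g * h) &
    weight w a - weight w a' + (weight w b - weight w b')
      <= weight w m - weight w m'].
Proof.
have supp0 c (k : {mpoly R[N]}) : c \in msupp k -> k != 0.
  by apply: contraTneq => ->; rewrite msupp0.
move=> ag a'g bh b'h; have g0 := supp0 _ _ ag; have h0 := supp0 _ _ bh.
have [c cg cmax] := max_weight w g0; have [d dh dmax] := max_weight w h0.
have [c' c'g cmin] := max_weight (fun k => - w k) g0.
have [d' d'h dmin] := max_weight (fun k => - w k) h0.
have [m mgh mE] := max_weightM cg cmax dh dmax.
have [m' m'gh m'E] := max_weightM c'g cmin d'h dmin.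
exists m, m'; split=> //; move: m'E (cmin _ a'g) (dmin _ b'h) (cmax _ ag) (dmax _ bh).
by rewrite !weightN; lia.
Qed.

Lemma weight_coord k m : weight (fun l => (l == k)%:Z) m = (m k)%:Z.
Proof.
rewrite /weight (bigD1 k) //= eqxx mul1r big1 ?addr0 // => l /negPf->.
by rewrite mul0r.
Qed.

Lemma msupp_singletonP g : g != 0 ->
  (forall a b, a \in msupp g -> b \in msupp g -> a = b) ->
  exists2 m, g@_m != 0 & g = g@_m *: 'X_[m].
Proof.
move=> g0 gE; have [m mg _] := max_weight (fun=> 0) g0.
exists m; first by rewrite -mcoeff_msupp.
apply/mpolyP=> b; rewrite mcoeffZ mcoeffX; case: eqP => [->|mb].
  by rewrite mulr1.
by rewrite mulr0 memN_msupp_eq0 //; apply/negP=> bg; apply: mb; apply: gE.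
Qed.

(** The Newton polytope of a monomial is a point, and so are those of its
    divisors. *)
Lemma divisor_monomial g h : g * h != 0 ->
    (forall a b, a \in msupp (g * h) -> b \in msupp (g * h) -> a = b) ->
  exists2 m, g@_m != 0 & g = g@_m *: 'X_[m].
Proof.
move=> gh0 ghE; have [g0 h0] : g != 0 /\ h != 0.
  by apply/andP; rewrite -negb_or -mulf_eq0.
apply: msupp_singletonP => // a b ag bg; apply/mnmP=> k.
have [c ch _] := max_weight (fun=> 0) h0.
have [m [m' [ms m's]]] := width_mul (fun l => (l == k)%:Z) ag bg ch ch.
have [p [p' [ps p's]]] := width_mul (fun l => (l == k)%:Z) bg ag ch ch.
by rewrite !(ghE _ _ ms m's) !(ghE _ _ ps p's) !weight_coord; lia.
Qed.

Definition mdiff a b (k : 'I_N) : int := (a k)%:Z - (b k)%:Z.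

Lemma weight_mdiff w a b : weight w a - weight w b = \sum_k w k * mdiff a b k.
Proof. by rewrite -sumrB; apply: eq_bigr => k _; rewrite mulrBr. Qed.

(** If the direction [a - b] is primitive, the segment from [a] to [b] is not a
    Minkowski sum of two lattice segments. *)
Lemma primitive_segment_irreducible a b g h w0 :
    (forall m, m \in msupp (g * h) -> (m == a) || (m == b)) ->
    weight w0 a - weight w0 b = 1 -> g * h != 0 ->
  (exists2 m, g@_m != 0 & g = g@_m *: 'X_[m]) \/
  (exists2 m, h@_m != 0 & h = h@_m *: 'X_[m]).
Proof.
move=> ghE w0E gh0; have [g0 h0] : g != 0 /\ h != 0.
  by apply/andP; rewrite -negb_or -mulf_eq0.
pose v := mdiff a b.
have widthE w a1 a2 b1 b2 : a1 \in msupp g -> a2 \in msupp g ->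
    b1 \in msupp h -> b2 \in msupp h ->
    weight w a1 - weight w a2 + (weight w b1 - weight w b2)
      <= `|weight w a - weight w b|.
  move=> a1g a2g b1h b2h; have [m [m' [/ghE]]] := width_mul w a1g a2g b1h b2h.
  by move=> + /ghE => /orP[]/eqP-> /orP[]/eqP->; lia.
have w0M (u : 'I_N -> int) k :
    \sum_l ((l == k)%:Z - v k * w0 l) * u l = u k - v k * (\sum_l w0 l * u l).
  rewrite mulr_sumr.
  under eq_bigr => l _ do rewrite mulrBl -mulrA.
  rewrite sumrB; congr (_ - _); rewrite (bigD1 k) //= eqxx mul1r big1 ?addr0 //.
  by move=> l /negPf->; rewrite mul0r.
(* these weights vanish on a - b and, together with w0, span all weights *)
have orth k : weight (fun l => (l == k)%:Z - v k * w0 l) a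
            - weight (fun l => (l == k)%:Z - v k * w0 l) b = 0.
  by rewrite weight_mdiff w0M -weight_mdiff w0E mulr1 subrr.
have [[a1 [a2 [a1g a2g w12]]]|gP] := pselect (exists a1 a2,
    [/\ a1 \in msupp g, a2 \in msupp g & weight w0 a1 < weight w0 a2]).
  right; apply: msupp_singletonP => // b1 b2 b1h b2h.
  have wb : weight w0 b1 - weight w0 b2 = 0.
    have := widthE w0 _ _ _ _ a2g a1g b1h b2h.
    have := widthE w0 _ _ _ _ a2g a1g b2h b1h.
    by rewrite w0E; lia.
  apply/mnmP=> k; have := orth k; set w := fun l => _ => wab.
  have := widthE w _ _ _ _ a1g a1g b1h b2h; have := widthE w _ _ _ _ a1g a1g b2h b1h.
  have : weight w b1 - weight w b2 = mdiff b1 b2 k.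
    by rewrite weight_mdiff w0M -weight_mdiff wb mulr0 subr0.
  by rewrite wab /mdiff; lia.
left; apply: msupp_singletonP => // a1 a2 a1g a2g.
have wa : weight w0 a1 - weight w0 a2 = 0.
  apply/eqP; rewrite subr_eq0; apply/eqP/le_anti; rewrite !leNgt.
  by apply/andP; split; apply/negP => lt12; case: gP; [exists a2, a1 | exists a1, a2].
have [b1 b1h _] := max_weight (fun=> 0) h0.
apply/mnmP=> k; have := orth k; set w := fun l => _ => wab.
have := widthE w _ _ _ _ a1g a2g b1h b1h; have := widthE w _ _ _ _ a2g a1g b1h b1h.
have : weight w a1 - weight w a2 = mdiff a1 a2 k.
  by rewrite weight_mdiff w0M -weight_mdiff wa mulr0 subr0.
by rewrite wab /mdiff; lia.
Qed.

(** Used for binomials [g]: one that divides a binomial has a parallel segment,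
    and one that divides a monomial would have a point for segment. *)
Lemma divisor_width0 g h a b w :
    a \in msupp g -> b \in msupp g -> g * h != 0 ->
    (forall m m', m \in msupp (g * h) -> m' \in msupp (g * h) ->
      weight w m = weight w m') ->
  weight w a = weight w b.
Proof.
move=> ag bg gh0 ghE; have h0 : h != 0.
  by apply: contraNneq gh0 => ->; rewrite mulr0.
have [c ch _] := max_weight (fun=> 0) h0.
have [m [m' [ms m's]]] := width_mul w ag bg ch ch.
have [p [p' [ps p's]]] := width_mul w bg ag ch ch.
by rewrite (ghE _ _ ms m's) (ghE _ _ ps p's); lia.
Qed.

End Weights.

(** * Extended variables as polynomial variables *)

Lemma mpolyC_int (N : nat) (R : comNzRingType) (z : int)
    (f : {rmorphism {mpoly int[N]} -> R}) :
  f z%:MP = z%:~R.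
Proof. by rewrite -{1}[z]intz -(rmorph_int f) -(rmorph_int (@mpolyC N int)). Qed.


(** The frozen variables [fv] make [S] a Laurent polynomial ring over the
    integers; the rest of the argument is uniform in such rings. *)
Definition frozen_generators (S : idomainType) (r : nat) (fv : 'I_r -> S) : Prop :=
  [/\ forall l, fv l \is a GRing.unit,
      injective (mmap (intr : int -> S) fv)
    & forall s, exists a p,
        s * mmap (intr : int -> S) fv 'X_[a] = mmap (intr : int -> S) fv p].

Lemma laurent_frozen r : frozen_generators (@laurent_var int r).
Proof.
have lE p : mmap intr (@laurent_var int r) p = lpoly p.
  apply: (mpoly_rmorph_ext (f := mmap intr (@laurent_var int r)) (g := @lpoly int r)).
    by move=> c; rewrite !mpolyC_int.
  by move=> l /=; rewrite mmapX mmap1U lpolyX.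
split=> [l|p q|s]; first exact: laurent_var_unit.
  by rewrite !lE; apply: lpoly_inj.
by have [p [a sE]] := laurent_clear s; exists a, p; rewrite !lE.
Qed.

Definition mutable_part n r (m : 'X_{1..n + r}) : 'X_{1..n} :=
  [multinom m (lshift r i) | i < n].

Definition frozen_part n r (m : 'X_{1..n + r}) : 'X_{1..r} :=
  [multinom m (rshift n l) | l < r].

Definition join_exponents n r (m : 'X_{1..n}) (a : 'X_{1..r}) : 'X_{1..n + r} :=
  [multinom match split k with inl i => m i | inr l => a l end | k < n + r].

Definition gext_var (S : idomainType) n r (fv : 'I_r -> S) (k : 'I_(n + r)) :
    {mpoly S[n]} :=
  match split k with inl i => 'X_i | inr l => (fv l)%:MP end.

(** Up to invertible frozen monomials, [S[x_1, ..., x_n]] is the image of the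
    polynomial ring over the integers in all extended variables. *)
Definition ext_poly (S : idomainType) n r (fv : 'I_r -> S) :
    {mpoly int[n + r]} -> {mpoly S[n]} :=
  mmap intr (gext_var fv).

HB.instance Definition _ (S : idomainType) n r (fv : 'I_r -> S) :=
  GRing.RMorphism.copy (@ext_poly S n r fv) (mmap intr (gext_var fv)).

Definition frozen_poly (S : idomainType) r (fv : 'I_r -> S) : {mpoly int[r]} -> S :=
  mmap intr fv.

HB.instance Definition _ (S : idomainType) r (fv : 'I_r -> S) :=
  GRing.RMorphism.copy (@frozen_poly S r fv) (mmap intr fv).

Section ExtendedRing.
Variables (S : idomainType) (n r : nat) (fv : 'I_r -> S).
Hypothesis fvP : frozen_generators fv.
Local Notation A := {mpoly S[n]}.
Local Notation P := {mpoly int[n + r]}.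
Local Notation ext_var := (gext_var (n := n) fv).
Local Notation ext_poly := (@ext_poly S n r fv).
Local Notation lpoly := (frozen_poly fv).

Let frozen_poly_inj : injective lpoly. Proof. by case: fvP. Qed.

Let frozen_clear s : exists a p, s * lpoly 'X_[a] = lpoly p.
Proof. by case: fvP. Qed.

Lemma frozen_polyX l : lpoly 'X_l = fv l.
Proof. by rewrite /frozen_poly mmapX mmap1U. Qed.

Lemma frozen_polyXm_unit a : lpoly 'X_[a] \is a GRing.unit.
Proof.
rewrite mpolyXE_id rmorph_prod; apply: (big_ind (fun x => x \is a GRing.unit)).
- exact: unitr1.
- by move=> x y xU yU; rewrite unitrM xU.
- by move=> i _; rewrite rmorphXn unitrX //= frozen_polyX; case: fvP.
Qed.

Lemma ext_var_lshift i : ext_var (lshift r i) = 'X_i :> A.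
Proof. by rewrite /gext_var -[lshift r i]/(unsplit (inl i)) unsplitK. Qed.

Lemma ext_var_rshift l : ext_var (rshift n l) = (fv l)%:MP :> A.
Proof. by rewrite /gext_var -[rshift n l]/(unsplit (inr l)) unsplitK. Qed.

Lemma ext_polyXm m : ext_poly 'X_[m] = \prod_k ext_var k ^+ m k.
Proof. exact: mmapX. Qed.

Lemma ext_polyXmE m :
  ext_poly 'X_[m] = lpoly 'X_[frozen_part m] *: 'X_[mutable_part m].
Proof.
rewrite ext_polyXm big_split_ord /= mulrC -mul_mpolyC; congr (_ * _).
  rewrite mpolyXE_id !rmorph_prod; apply: eq_bigr => l _.
  by rewrite ext_var_rshift !rmorphXn mnmE /= frozen_polyX.
by rewrite mpolyXE_id; apply: eq_bigr => i _; rewrite ext_var_lshift mnmE.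
Qed.

Lemma mcoeff_ext_poly p e : (ext_poly p)@_e =
  lpoly (\sum_(m <- msupp p | mutable_part m == e) p@_m *: 'X_[frozen_part m]).
Proof.
rewrite {1}(mpolyE p) !rmorph_sum raddf_sum [RHS]big_mkcond /=.
apply: eq_bigr => m _; rewrite -mul_mpolyC rmorphM mpolyC_int /= ext_polyXmE.
rewrite mulrzl -scaler_int scalerA mcoeffZ mcoeffX.
case: eqP => _; last by rewrite mulr0.
by rewrite mulr1 -mul_mpolyC rmorphM mpolyC_int.
Qed.

Lemma ext_poly_inj : injective ext_poly.
Proof.
apply: raddf_inj => p p0; apply/mpolyP=> m; rewrite mcoeff0.
have := mcoeff_ext_poly p (mutable_part m); rewrite p0 mcoeff0 => /esym/eqP.
rewrite -(rmorph0 lpoly) => /eqP/frozen_poly_inj/(congr1 (mcoeff (frozen_part m))).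
rewrite mcoeff0 -big_filter raddf_sum /=.
under eq_bigr => b _ do rewrite mcoeffZ mcoeffX.
have [mp|/memN_msupp_eq0//] := boolP (m \in msupp p).
rewrite (bigD1_seq m) ?filter_uniq ?msupp_uniq ?mem_filter ?eqxx //= mulr1.
rewrite big_seq_cond big1 ?addr0 // => b.
rewrite mem_filter -andbA => /and3P[/eqP mb _ bm].
case: eqP => [fb|]; last by rewrite mulr0.
case/eqP: bm; apply/mnmP=> k; rewrite -(splitK k); case: (split k) => [i|l] /=.
  by move/mnmP: mb => /(_ i); rewrite !mnmE.
by move/mnmP: fb => /(_ l); rewrite !mnmE.
Qed.

Definition of_frozen : {mpoly int[r]} -> P := mmap intr (fun l => 'X_(rshift n l)).

HB.instance Definition _ := GRing.RMorphism.copy of_frozen of_frozen.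

Lemma ext_poly_frozen q : ext_poly (of_frozen q) = (lpoly q)%:MP.
Proof.
apply: (mpoly_rmorph_ext (f := ext_poly \o of_frozen) (g := @mpolyC n S \o lpoly)).
  by move=> c; rewrite !mpolyC_int.
move=> l /=; rewrite /of_frozen mmapX mmap1U ext_polyXm frozen_polyX -ext_var_rshift.
rewrite (bigD1 (rshift n l)) //= mnm1E eqxx big1 ?mulr1 // => k /negPf kl.
by rewrite mnm1E eq_sym kl.
Qed.

Lemma ext_poly_join m a :
  ext_poly 'X_[join_exponents m a] = lpoly 'X_[a] *: 'X_[m].
Proof.
rewrite ext_polyXmE; congr (lpoly 'X_[_] *: 'X_[_]); apply/mnmP=> k; rewrite !mnmE.
  by rewrite -[rshift n k]/(unsplit (inr k)) unsplitK.
by rewrite -[lshift r k]/(unsplit (inl k)) unsplitK.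
Qed.

(** Denominators of the coefficients are frozen monomials. *)
Lemma ext_poly_clear p : exists a q, lpoly 'X_[a] *: p = ext_poly q.
Proof.
elim/mpolyind: p => [|c m p _ _ [b [q pE]]].
  by exists 0%MM, 0; rewrite scaler0 rmorph0.
have [a [d cE]] := frozen_clear c; exists (a + b)%MM.
exists (of_frozen 'X_[b] * (of_frozen d * 'X_[join_exponents m 0])
        + of_frozen 'X_[a] * q).
rewrite rmorphD !rmorphM /= !ext_poly_frozen -pE ext_poly_join mpolyX0 rmorph1 scale1r.
rewrite -cE !mul_mpolyC scalerDr mpolyXD rmorphM /= !scalerA.
by rewrite [_ * c]mulrC [_ * (c * _)]mulrCA [lpoly 'X_[b] * _]mulrC.
Qed.

Lemma ext_dvd_clear f h : rdvd (ext_poly f) (ext_poly h) ->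
  exists m q, f * q = 'X_[m] * h.
Proof.
case=> g hE; have [a [q gE]] := ext_poly_clear g.
exists (join_exponents 0 a), q; apply: ext_poly_inj.
rewrite !rmorphM /= ext_poly_join mpolyX0 -gE hE -!mul_mpolyC mulr1.
by rewrite mulrCA [in LHS](mulrC _ g).
Qed.

(** A division in the Laurent ring of [S[x_1, ..., x_n]] becomes one between
    integral polynomials, at the cost of monomials. *)
Lemma ldvd_clear p f : ldvd p%:F (ext_poly f)%:F ->
  exists a m q g, lpoly 'X_[a] *: p = ext_poly q /\ q * g = 'X_[m] * f.
Proof.
case=> _ [h [b ->]] fE; have [a [q pE]] := ext_poly_clear p.
have X0 : ('X_[b] : A)%:F != 0 by rewrite tofrac_eq0 -msupp_eq0 msuppX.
have /ext_dvd_clear[m [g qg]] : rdvd (ext_poly q)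
    (ext_poly ('X_[join_exponents 0 a] * 'X_[join_exponents b 0] * f)).
  exists h; rewrite !rmorphM /= !ext_poly_join !mpolyX0 rmorph1 scale1r -pE.
  apply/eqP; rewrite -tofrac_eq -!mul_mpolyC mulr1 !tofracM fE; apply/eqP.
  have clear (K : fieldType) (x y z t : K) : z != 0 ->
    x * z * (y / z * t) = y * (x * t) by move=> z0; field.
  exact: clear.
exists a, (m + (join_exponents 0 a + join_exponents b 0))%MM, q, g; split=> //.
by rewrite qg !mpolyXD !mulrA.
Qed.

(** The frozen variables are units of [S], so only the cluster variables in the
    monomial can prevent [p] from being invertible. *)
Lemma monomial_unit_or_var (p : A) (u : S) (q : P) m (z : int) :
    u \is a GRing.unit -> z \is a GRing.unit -> u *: p = ext_poly q ->
    q = z *: 'X_[m] ->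
  p \is a GRing.unit \/ exists k, rdvd 'X_k p.
Proof.
move=> uU zU pE qE.
have {pE qE} pE : p = (u^-1 * z%:~R * lpoly 'X_[frozen_part m]) *: 'X_[mutable_part m].
  have {pE} -> : p = u^-1 *: ext_poly q by rewrite -pE scalerA mulVr // scale1r.
  rewrite qE -[z *: _]mul_mpolyC rmorphM mpolyC_int /=.
  by rewrite ext_polyXmE mulrzl -scaler_int !scalerA.
have [m0|/eqP/mnmP m0] := eqVneq (mutable_part m) 0%MM.
  left; rewrite pE m0 mpolyX0 alg_mpolyC rmorph_unit //.
  rewrite !unitrM unitrV uU frozen_polyXm_unit.
  by rewrite (rmorph_unit intr).
right; have [k mk] : exists k, mutable_part m k != 0%N.
  apply/existsP; rewrite -negb_forall; apply/forallP=> m1.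
  by apply: m0 => k; rewrite mnm0E; apply/eqP.
exists k, ((u^-1 * z%:~R * lpoly 'X_[frozen_part m]) *: 'X_[mutable_part m - U_(k)]).
by rewrite -scalerAl -mpolyXD submK ?lep1mP // pE.
Qed.

Lemma ldvd_monomial p m : ldvd p%:F (ext_poly 'X_[m])%:F ->
  p \is a GRing.unit \/ exists k, rdvd 'X_k p.
Proof.
case/ldvd_clear=> a [m' [q [g [pE]]]]; rewrite -mpolyXD => qg.
have [|b c|b b0 qE] := @divisor_monomial _ _ q g.
- by rewrite qg -msupp_eq0 msuppX.
- by rewrite qg msuppX !inE => /eqP-> /eqP->.
apply: (monomial_unit_or_var _ _ pE qE); first exact: frozen_polyXm_unit.
apply/unitrPr; exists ('X_[b] * g)@_(m' + m).
by rewrite -mcoeffZ scalerAl -qE qg mcoeffX eqxx.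
Qed.

End ExtendedRing.

(** * Exchange matrices under mutation *)

Definition pospart (x : int) : int := if 0 < x then x else 0.

Lemma pospart_sym (x y : int) :
  x * pospart (- sgz x * y) = - (y * pospart (- sgz y * x)).
Proof.
rewrite /pospart; have [->|x0|x0] := sgzP x; have [->|y0|y0] := sgzP y.
all: rewrite ?mulr0 ?mul0r ?oppr0 ?mulN1r ?opprK ?mul1r ?oppr_gt0 ?ltxx //.
all: by rewrite ?x0 ?y0 ?(lt_gtF x0) ?(lt_gtF y0) ?mulr0 ?oppr0 //; ring.
Qed.

Lemma pospart_sgz (x y : int) :
  y * pospart (sgz y * x) = y * pospart x + x * pospart (- y).
Proof.
rewrite /pospart; have [->|y0|y0] := sgzP y; rewrite ?oppr_gt0.
- by rewrite !mul0r ltxx mulr0 addr0.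
- by rewrite mul1r (lt_gtF y0) mulr0 addr0.
- rewrite mulN1r oppr_gt0 y0; have [x0|x0|->] := ltgtP x 0; rewrite ?mulr0; ring.
Qed.

Lemma bezout_big N (v : 'I_N -> int) :
  exists w : 'I_N -> int, \sum_k w k * v k = (\big[gcdn/0%N]_(k < N) `|v k|%N)%:Z.
Proof.
elim: N v => [|N IHN] v; first by exists (fun=> 0); rewrite !big_ord0.
have [w wE] := IHN (fun k => v (lift ord0 k)).
have [a [b abE]] := Bezoutz (v ord0) (\big[gcdn/0%N]_(k < N) `|v (lift ord0 k)|%N)%:Z.
exists (fun k => if unlift ord0 k is Some l then b * w l else a).
rewrite !big_ord_recl unlift_none; under eq_bigr => k _ do rewrite liftK -mulrA.
by rewrite -mulr_sumr wE abE.
Qed.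

Section Matrices.
Variables n r : nat.
Implicit Types (B : 'M[int]_(n + r, n)) (i j : 'I_n).

Definition skew_scaled B : Prop := exists d : 'I_n -> rat,
  (forall i, 0 < d i) /\
  (forall i j, d i * (B (lshift r i) j)%:~R = - (d j * (B (lshift r j) i)%:~R)).

(** Primitivity as a Bezout relation: [w] is a weight for which the two exponents
    of [F_j] differ by 1. *)
Definition unimodular_columns B : Prop :=
  forall j, exists w : 'I_(n + r) -> int, \sum_k w k * B k j = 1.

Definition free_columns B : Prop := forall v : 'I_n -> int,
  (forall k, \sum_j B k j * v j = 0) -> forall j, v j = 0.

Lemma skew_symmetrizable_scaled B : skew_symmetrizable (usubmx B) -> skew_scaled B.
Proof.
case=> d [d0 dE]; exists (d 0); split=> // i j.
by have /matrixP/(_ j i) := dE; rewrite mxE !mul_diag_mx !mxE.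
Qed.

Lemma primitive_unimodular B : primitive B -> unimodular_columns B.
Proof. by move=> Bp j; have [w wE] := bezout_big (B^~ j); exists w; rewrite wE Bp. Qed.

Lemma full_rank_free B : full_rank B -> free_columns B.
Proof.
move=> /eqP Bf v v0.
have {Bf} /row_fullP[C CB] : row_full (map_mx intr B : 'M[rat]__) by [].
pose V : 'cV[rat]_n := \col_j (v j)%:~R.
have V0 : V = 0.
  rewrite -[V]mul1mx -CB -mulmxA (_ : map_mx intr B *m V = 0) ?mulmx0 //.
  apply/matrixP=> k l; rewrite !mxE -[RHS](rmorph0 intr) -(v0 k) rmorph_sum.
  by apply: eq_bigr => j _; rewrite !mxE rmorphM.
move=> j; have /matrixP/(_ j 0) := V0; rewrite !mxE => /eqP.
by rewrite intr_eq0 => /eqP.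
Qed.

(** In this form the change of column [j] is [B i j] times a vector that depends
    on [B i j] through its sign only. *)
Lemma mutate_matrixE B i j k : j != i -> k != lshift r i ->
  mutate_matrix B i k j =
    B k j + B (lshift r i) j * pospart (sgz (B (lshift r i) j) * B k i).
Proof.
move=> /negPf ji /negPf ki; rewrite mxE ki ji /=; congr (_ + _).
set a := B k i; set b := B (lshift r i) j; rewrite /pospart.
have -> : `|a| * b + a * `|b| = b * (if 0 < sgz b * a then sgz b * a else 0) * 2.
  have [->|_|_] := sgzP b; first by rewrite !mulr0 !mul0r.
    rewrite mul1r; case: (ltrP 0 a) => a0.
      by rewrite gtr0_norm //; ring.
    by rewrite ler0_norm //; ring.
  rewrite mulN1r oppr_gt0; case: (ltrP a 0) => a0.
    by rewrite ltr0_norm //; ring.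
  by rewrite ger0_norm //; ring.
by rewrite mulzK.
Qed.

Lemma mutate_matrix_col B i k : mutate_matrix B i k i = - B k i.
Proof. by rewrite mxE eqxx orbT. Qed.

Lemma mutate_matrix_row B i j : mutate_matrix B i (lshift r i) j = - B (lshift r i) j.
Proof. by rewrite mxE eqxx. Qed.

Lemma skew_diag0 B i : skew_scaled B -> B (lshift r i) i = 0.
Proof.
case=> d [d0 /(_ i i)dE]; apply/eqP; rewrite -(intr_eq0 rat).
by rewrite -(mulrI_eq0 _ (mulfI (lt0r_neq0 (d0 i)))); apply/eqP; lra.
Qed.

Lemma skew_sgz B i j : skew_scaled B ->
  sgz (B (lshift r i) j) = - sgz (B (lshift r j) i).
Proof.
case=> d [d0 /(_ i j)dE].
have := congr1 (@sgz rat) dE; rewrite sgzN !sgzM !(gtr0_sgz (d0 _)) !mul1r.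
by rewrite !sgz_int.
Qed.

(** The same scaling works; [pospart_sym] compares the changes of the entries
    [(j, k)] and [(k, j)]. *)
Lemma skew_mutate B i : skew_scaled B -> skew_scaled (mutate_matrix B i).
Proof.
move=> Bs; have Bii := skew_diag0 i Bs; have sg j := skew_sgz i j Bs.
case: Bs => d [d0 dE]; exists d; split=> // j k.
have [->|ji] := eqVneq j i.
  by rewrite mutate_matrix_row mutate_matrix_col !rmorphN !mulrN dE opprK.
have [->|ki] := eqVneq k i.
  by rewrite mutate_matrix_row mutate_matrix_col !rmorphN !mulrN dE opprK.
rewrite !mutate_matrixE ?(inj_eq (@lshift_inj _ _)) // !rmorphD !rmorphM /=.
rewrite !mulrDr dE opprD; congr (_ + _).
rewrite !sg; set bj := B _ i; set bk := B _ i.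
apply: (mulfI (lt0r_neq0 (d0 i))); rewrite mulrN !(mulrA (d i)).
have /(congr1 (fun z : int => z%:~R : rat)) := pospart_sym bj bk.
rewrite rmorphN !rmorphM /= -/bj -/bk => ppE.
rewrite mulrACA [in LHS](dE i k) [in RHS]mulrACA (dE i j) -/bj -/bk.
have -> (x y z t : rat) : - (x * y) * (z * t) = - (x * z) * (y * t) by ring.
by rewrite ppE; ring.
Qed.

(** Column [j] changes by multiples of its own entry in row [i], which the
    coefficient of that entry can absorb. *)
Lemma unimodular_mutate B i :
  unimodular_columns B -> unimodular_columns (mutate_matrix B i).
Proof.
move=> Bu j; have [w wE] := Bu j; have [->|ji] := eqVneq j i.
  have [u uE] := Bu i; exists (fun k => - u k); rewrite -uE.
  by apply: eq_bigr => k _; rewrite mutate_matrix_col mulrNN.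
pose i' := lshift r i; pose c k := pospart (sgz (B i' j) * B k i).
pose t := \sum_(k < n + r | k != i') w k * c k.
exists (fun k => if k == i' then t - w i' else w k).
rewrite (bigD1 i') //= eqxx mutate_matrix_row -wE [in RHS](bigD1 i') //=.
rewrite mulrN -mulNr opprB mulrBl mulr_suml -addrA; congr (_ + _).
rewrite addrC -sumrB; apply: eq_bigr => k ki; rewrite (negPf ki) mutate_matrixE //.
by rewrite -/i' -/(c k) mulrDr [B i' j * _]mulrC mulrA addrK.
Qed.

(** Mutation multiplies the matrix on both sides by unimodular ones; [u] is the
    image of [v] under the right factor. *)
Lemma free_mutate B i :
  skew_scaled B -> free_columns B -> free_columns (mutate_matrix B i).
Proof.
move=> /(skew_diag0 i) Bii Bf v v0; pose i' := lshift r i.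
pose t := \sum_(j < n | j != i) pospart (- B i' j) * v j.
pose u j := if j == i then t - v i else v j.
have row0 : \sum_(j < n | j != i) B i' j * v j = 0.
  have := v0 i'; rewrite (bigD1 i) //= mutate_matrix_col Bii oppr0 mul0r add0r.
  under eq_bigr => j _ do rewrite mutate_matrix_row mulNr.
  by rewrite sumrN => /eqP; rewrite oppr_eq0 => /eqP.
have uE k : \sum_(j < n) B k j * u j =
    B k i * (t - v i) + \sum_(j < n | j != i) B k j * v j.
  rewrite (bigD1 i) //= {1}/u eqxx; congr (_ + _).
  by apply: eq_bigr => j /negPf ji; rewrite /u ji.
have u0 : forall j, u j = 0.
  apply: Bf => k; rewrite uE; have [->|ki] := eqVneq k i'.
    by rewrite row0 Bii mul0r addr0.
  have := v0 k; rewrite (bigD1 i) //= mutate_matrix_col.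
  under eq_bigr => j ji do
    rewrite mutate_matrixE // pospart_sgz addrCA mulrDl
            [_ * pospart (B k i)]mulrC -mulrA.
  rewrite big_split /= -mulr_sumr row0 mulr0 add0r.
  under eq_bigr => j ji do rewrite mulrDl -mulrA.
  rewrite big_split /= -mulr_sumr -/t => tE; rewrite -[RHS]tE; ring.
have vu j : j != i -> v j = 0 by move=> /negPf ji; have := u0 j; rewrite /u ji.
move=> j; have [->|] := eqVneq j i; last exact: vu.
have := u0 i; rewrite /u eqxx /t big1 => [|k /vu->]; last by rewrite mulr0.
by rewrite sub0r => /eqP; rewrite oppr_eq0 => /eqP.
Qed.

Definition same_columns_up_to_sign B B' : Prop :=
  forall j, (forall k, B k j = B' k j) \/ (forall k, B k j = - B' k j).

(** The signs agree on columns [i] and [j] as soon as the [(i, j)] entry is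
    nonzero, since it and the [(j, i)] entry have opposite signs. *)
Lemma mutate_columns_up_to_sign B B' i : skew_scaled B -> skew_scaled B' ->
    same_columns_up_to_sign B B' ->
  same_columns_up_to_sign (mutate_matrix B i) (mutate_matrix B' i).
Proof.
move=> Bs B's BB' j; have [->|ji] := eqVneq j i.
  by case: (BB' i) => Bi; [left=> k | right=> k]; rewrite !mutate_matrix_col Bi.
have [b0|b0] := eqVneq (B' (lshift r i) j) 0.
  have b0' : B (lshift r i) j = 0 by case: (BB' j) => ->; rewrite b0 ?oppr0.
  have BE k : mutate_matrix B i k j = B k j /\ mutate_matrix B' i k j = B' k j.
    have [->|ki] := eqVneq k (lshift r i).
      by rewrite !mutate_matrix_row b0' b0 oppr0.
    by rewrite !mutate_matrixE // b0 b0' !mul0r !addr0.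
  by case: (BB' j) => Bj; [left=> k | right=> k]; have [-> ->] := BE k.
have := skew_sgz i j Bs; have := skew_sgz i j B's.
case: (BB' j) (BB' i) => Bj [] Bi; rewrite Bj Bi ?sgzN => -> /eqP.
- move=> _; left=> k; have [->|ki] := eqVneq k (lshift r i).
    by rewrite !mutate_matrix_row Bj.
  by rewrite !mutate_matrixE // !Bj Bi.
- by rewrite opprK -subr_eq0 => /eqP sE; case/eqP: b0; apply/eqP;
    rewrite -sgz_eq0 (skew_sgz i j B's); lia.
- by rewrite opprK -subr_eq0 => /eqP sE; case/eqP: b0; apply/eqP;
    rewrite -sgz_eq0 (skew_sgz i j B's); lia.
- move=> _; right=> k; have [->|ki] := eqVneq k (lshift r i).
    by rewrite !mutate_matrix_row Bj.
  by rewrite !mutate_matrixE // !Bj Bi sgzN mulrNN mulNr -opprD.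
Qed.

End Matrices.

(** * Exchange polynomials *)

HB.instance Definition _ (S : idomainType) (n : nat) :=
  GRing.RMorphism.copy (@cstQ S n)
    (@FracField.tofrac {mpoly S[n]} \o @mpolyC n S).

HB.instance Definition _ (S : idomainType) (n : nat) :=
  GRing.RMorphism.copy (@ground S n)
    (@FracField.tofrac {mpoly {fraction S}[n]} \o @mpolyC n {fraction S}
       \o @FracField.tofrac S).

Section Evaluation.
Variables (S : idomainType) (n : nat).
Local Notation P := {mpoly S[n]}.

Lemma mmap_free (E : comNzRingType) (h : {rmorphism S -> E}) (y z : 'I_n -> E)
    i (p : P) :
  free_of i p -> (forall k, k != i -> y k = z k) -> mmap h y p = mmap h z p.
Proof.
move=> /allP pi yz; rewrite /mmap !big_seq; apply: eq_bigr => m /pi/eqP mi.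
congr (_ * _); apply: eq_bigr => k _; have [->|/yz->//] := eqVneq k i.
by rewrite mi !expr0.
Qed.

Lemma mmap_varQ (p : P) : mmap (@cstQ S n) (@varQ S n) p = p%:F.
Proof.
apply: (mpoly_rmorph_ext (f := mmap (@cstQ S n) (@varQ S n))
          (g := @FracField.tofrac P)) => [c|i] /=.
  by rewrite mmapC.
by rewrite mmapX mmap1U.
Qed.

Lemma leval0 (E : fieldType) (h : {rmorphism S -> E}) (p : P) y :
  leval h (fun=> 0) p y = mmap h y p.
Proof. by rewrite /leval big1 ?mul1r // => k _; rewrite expr0z. Qed.

Lemma laurentP (q : {fraction P}) : reflect (is_laurent q) (q \in @laurent_pred S n).
Proof. exact: asboolP. Qed.

Lemma tofrac_laurent (p : P) : p%:F \in @laurent_pred S n.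
Proof. by apply/laurentP; exists p, 0%MM; rewrite mpolyX0 tofrac1 divr1. Qed.

Lemma mmap_laurent (y : 'I_n -> {fraction P}) (p : P) :
    (forall k, y k \in @laurent_pred S n) ->
  mmap (@cstQ S n) y p \in @laurent_pred S n.
Proof.
move=> yL; rewrite /mmap; apply: (@rpred_sum _ (@laurent_pred S n)) => m _.
apply: rpredM; first exact: tofrac_laurent.
by apply: rpred_prod => k _; apply: rpredX.
Qed.

Lemma ldvd_sub (p : P) (q1 q2 : {fraction P}) :
  ldvd p%:F (q1 + q2) -> ldvd p%:F q1 -> ldvd p%:F q2.
Proof.
move=> [h1 h1L e1] [h2 h2L e2]; exists (h1 - h2); last first.
  by rewrite mulrBl -e1 -e2 addrAC subrr add0r.
by apply/laurentP; apply: (@rpredB _ (@laurent_pred S n)); apply/laurentP.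
Qed.

End Evaluation.

Lemma pair_eqP (T : eqType) (a b c d : T) :
    (a == c) || (a == d) -> (b == c) || (b == d) ->
    (c == a) || (c == b) -> (d == a) || (d == b) ->
  a = c /\ b = d \/ a = d /\ b = c.
Proof.
by move=> /orP[]/eqP e1 /orP[]/eqP e2 /orP[]/eqP e3 /orP[]/eqP e4; subst;
  by [left | right].
Qed.

Section Binomials.
Variable N : nat.
Implicit Types v w : 'I_N -> int.

Definition pos_exp v : 'X_{1..N} :=
  [multinom if (0 < v k)%R then absz (v k) else 0%N | k < N].

Definition neg_exp v := pos_exp (fun k => - v k).

Lemma pos_expE v k : (pos_exp v k)%:Z = pospart (v k).
Proof. by rewrite mnmE /pospart; case: ifP => // /gtz0_abs. Qed.

Lemma neg_expE v k : (neg_exp v k)%:Z = pospart (- v k).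
Proof. exact: pos_expE. Qed.

Lemma pospartB (x : int) : pospart x - pospart (- x) = x.
Proof. by rewrite /pospart oppr_gt0; case: ltgtP => // *; lia. Qed.

Lemma mdiff_pos_neg v k : mdiff (pos_exp v) (neg_exp v) k = v k.
Proof. by rewrite /mdiff pos_expE neg_expE pospartB. Qed.

Definition binomial v : {mpoly int[N]} := 'X_[pos_exp v] + 'X_[neg_exp v].

Lemma msupp_binomial (a b m : 'X_{1..N}) :
  (m \in msupp ('X_[a] + 'X_[b] : {mpoly int[N]})) = (m == a) || (m == b).
Proof.
rewrite mcoeff_msupp mcoeffD !mcoeffX [m == a]eq_sym [m == b]eq_sym.
by case: (a == m); case: (b == m).
Qed.

Lemma mulX_binomial m v :
  'X_[m] * binomial v = 'X_[m + pos_exp v] + 'X_[m + neg_exp v].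
Proof. by rewrite mulrDr !mpolyXD. Qed.

Lemma binomial_neq0 v : binomial v != 0.
Proof.
rewrite -msupp_eq0; apply/eqP => v0.
by have := msupp_binomial (pos_exp v) (neg_exp v) (pos_exp v); rewrite eqxx [msupp _]v0.
Qed.

Lemma weight_binomial w v :
  weight w (pos_exp v) - weight w (neg_exp v) = \sum_k w k * v k.
Proof. by rewrite weight_mdiff; apply: eq_bigr => k _; rewrite mdiff_pos_neg. Qed.

Lemma binomial_eq v w : binomial v = binomial w ->
  (forall k, v k = w k) \/ (forall k, v k = - w k).
Proof.
move=> vw; have sE m : (m == pos_exp v) || (m == neg_exp v)
    = (m == pos_exp w) || (m == neg_exp w).
  by rewrite -!msupp_binomial -/(binomial v) -/(binomial w) vw.
have [[pE nE]|[pE nE]] : pos_exp v = pos_exp w /\ neg_exp v = neg_exp w \/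
    pos_exp v = neg_exp w /\ neg_exp v = pos_exp w.
- apply: pair_eqP; rewrite -?sE ?eqxx ?orbT //; first by rewrite sE eqxx.
  by rewrite sE eqxx orbT.
- by left=> k; rewrite -(mdiff_pos_neg v) -(mdiff_pos_neg w) /mdiff pE nE.
- by right=> k; rewrite -(mdiff_pos_neg v) -(mdiff_pos_neg w) /mdiff pE nE opprB.
Qed.

Lemma binomial_sign v w :
  (forall k, v k = w k) \/ (forall k, v k = - w k) -> binomial v = binomial w.
Proof.
have posE u u' : (forall k, u k = u' k) -> pos_exp u = pos_exp u'.
  by move=> uu; apply/mnmP=> k; rewrite !mnmE uu.
case=> vw; rewrite /binomial /neg_exp.
  by congr ('X_[_] + 'X_[_]); apply: posE => k; rewrite vw.
by rewrite addrC; congr ('X_[_] + 'X_[_]); apply: posE => k; rewrite vw ?opprK.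
Qed.

End Binomials.

Definition gexchange (S : idomainType) n r (fv : 'I_r -> S) (B : 'M[int]_(n + r, n))
    (j : 'I_n) : {mpoly S[n]} :=
  \prod_(k < n + r | 0 < B k j) gext_var fv k ^+ `|B k j|%N +
  \prod_(k < n + r | B k j < 0) gext_var fv k ^+ `|B k j|%N.

Section ExchangePolynomials.
Variables (S : idomainType) (n r : nat) (fv : 'I_r -> S).
Hypothesis fvP : frozen_generators fv.
Local Notation A := {mpoly S[n]}.
Local Notation Q := {fraction {mpoly S[n]}}.
Local Notation ext_var := (gext_var (n := n) fv).
Local Notation ext_poly := (@ext_poly S n r fv).
Local Notation exchange_poly := (gexchange fv).
Implicit Types (B : 'M[int]_(n + r, n)) (i j : 'I_n).

Lemma exchange_polyE B j : exchange_poly B j = ext_poly (binomial (B^~ j)).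
Proof.
rewrite rmorphD /= !ext_polyXm.
congr (_ + _); rewrite big_mkcond; apply: eq_bigr => k _.
  by rewrite mnmE; case: ifP.
by rewrite mnmE oppr_gt0 abszN; case: ifP.
Qed.

Lemma exchange_sign B B' j :
    (forall k, B k j = B' k j) \/ (forall k, B k j = - B' k j) ->
  exchange_poly B j = exchange_poly B' j.
Proof. by move=> BB'; rewrite !exchange_polyE (binomial_sign BB'). Qed.

Lemma exchange_polyD B j :
  exchange_poly B j = ext_poly 'X_[pos_exp (B^~ j)] + ext_poly 'X_[neg_exp (B^~ j)].
Proof. by rewrite exchange_polyE /binomial rmorphD. Qed.

Lemma eval_exchange (h : {rmorphism S -> Q}) (y : 'I_n -> Q) B j :
  mmap h y (exchange_poly B j) =
    mmap h y (ext_poly 'X_[pos_exp (B^~ j)]) + mmap h y (ext_poly 'X_[neg_exp (B^~ j)]).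
Proof. by rewrite exchange_polyD mmapD. Qed.

Definition extQ (k : 'I_(n + r)) : Q := (ext_var k : A)%:F.

Lemma extQ_neq0 (k : 'I_(n + r)) : extQ k != 0.
Proof.
rewrite tofrac_eq0 /gext_var; case: split => l; first by rewrite -msupp_eq0 msuppX.
case: fvP => fvU _ _; rewrite mpolyC_eq0.
by apply: contraTneq (fvU l) => ->; rewrite unitr0.
Qed.

Lemma tofrac_extX (m : 'X_{1..n + r}) :
  (ext_poly 'X_[m] : A)%:F = \prod_k extQ k ^+ m k.
Proof.
by rewrite ext_polyXm rmorph_prod; apply: eq_bigr => k _; rewrite rmorphXn.
Qed.

Lemma tofrac_extX_neq0 (m : 'X_{1..n + r}) : (ext_poly 'X_[m] : A)%:F != 0.
Proof.
by rewrite tofrac_extX; apply/prodf_neq0 => k _; rewrite expf_neq0 ?extQ_neq0.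
Qed.

Definition drop_var (j : 'I_n) (m : 'X_{1..n + r}) : 'X_{1..n + r} :=
  [multinom if k == lshift r j then 0%N else m k | k < n + r].

Lemma drop_var_id j (m : 'X_{1..n + r}) : m (lshift r j) = 0%N -> drop_var j m = m.
Proof. by move=> mj; apply/mnmP=> k; rewrite mnmE; case: eqP => // ->. Qed.

(** This covers all substitutions in the rules of LP mutation: [0] and [F_j / x]
    for [x_j], and the remaining monomial over [x_i'] for [x_i]. *)
Lemma eval_set_var j (z : Q) (m : 'X_{1..n + r}) :
  mmap (@cstQ S n) (set_var j z) (ext_poly 'X_[m])
    = (ext_poly 'X_[drop_var j m])%:F * z ^+ m (lshift r j).
Proof.
rewrite ext_polyXm rmorph_prod tofrac_extX.
rewrite (bigD1 (lshift r j)) //= [in RHS](bigD1 (lshift r j)) //= mnmE eqxx expr0 mul1r.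
rewrite mulrC rmorphXn /= ext_var_lshift mmapX mmap1U /set_var eqxx; congr (_ * _).
apply: eq_bigr => k; rewrite -(splitK k); case: (split k) => [i|l] /= kj.
  rewrite mnmE (negPf kj) rmorphXn /= /extQ ext_var_lshift mmapX mmap1U.
  by rewrite (inj_eq (@lshift_inj _ _)) in kj; rewrite (negPf kj).
by rewrite mnmE (negPf kj) rmorphXn /= /extQ ext_var_rshift mmapC.
Qed.

(** At least one of the two terms survives at [x_k = 0]. *)
Lemma exchange_var_ndvd B j (k : 'I_n) : ~ rdvd 'X_k (exchange_poly B j).
Proof.
case=> c /(congr1 (mmap (@cstQ S n) (set_var k 0))).
rewrite rmorphM /= mmapX mmap1U [set_var k 0 k]ifT // mulr0.
rewrite eval_exchange !eval_set_var => /eqP.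
have pn : (pos_exp (B^~ j) (lshift r k) == 0%N) ||
          (neg_exp (B^~ j) (lshift r k) == 0%N).
  by rewrite !mnmE oppr_gt0; case: (ltgtP (B (lshift r k) j) 0); rewrite ?orbT.
have [p0|p0] := eqVneq (pos_exp (B^~ j) (lshift r k)) 0%N; last first.
  rewrite (negPf p0) /= in pn.
  rewrite expr0n (negPf p0) mulr0 add0r (eqP pn) expr0 mulr1.
  by rewrite (negPf (tofrac_extX_neq0 _)).
have [q0|q0] := eqVneq (neg_exp (B^~ j) (lshift r k)) 0%N; last first.
  rewrite expr0n [in X in _ + X](expr0n) (negPf q0) mulr0 addr0 p0 mulr1.
  by rewrite (negPf (tofrac_extX_neq0 _)).
rewrite p0 q0 !expr0 !mulr1 !drop_var_id // -tofracD -exchange_polyD exchange_polyE.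
rewrite tofrac_eq0 -(rmorph0 ext_poly) (inj_eq (ext_poly_inj fvP)).
by rewrite (negPf (binomial_neq0 _)).
Qed.

Lemma free_of_exchange B i j : free_of i (exchange_poly B j) = (B (lshift r i) j == 0).
Proof.
apply/idP/idP => [fi|/eqP b0].
  have := @mmap_free _ _ _ (@cstQ S n) (set_var i 0) (@varQ S n) i _ fi.
  rewrite mmap_varQ eval_exchange !eval_set_var exchange_polyD tofracD => /(_ _) E.
  have {}/E : forall k, k != i -> set_var i 0 k = @varQ S n k.
    by move=> k /negPf ki; rewrite /set_var ki.
  have nz (m : 'X_{1..n + r}) : ((ext_poly 'X_[m] : A)%:F == 0) = false.
    by rewrite (negPf (tofrac_extX_neq0 m)).
  case: (ltgtP (B (lshift r i) j) 0) => // b0.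
    have p0 : pos_exp (B^~ j) (lshift r i) = 0%N by rewrite mnmE (lt_gtF b0).
    have q0 : neg_exp (B^~ j) (lshift r i) != 0%N.
      by rewrite mnmE oppr_gt0 b0 abszN absz_eq0 lt_eqF.
    rewrite p0 expr0 mulr1 expr0n (negPf q0) mulr0 drop_var_id //.
    by move=> /addrI/esym/eqP; rewrite nz.
  have q0 : neg_exp (B^~ j) (lshift r i) = 0%N by rewrite mnmE oppr_gt0 (lt_gtF b0).
  have p0 : pos_exp (B^~ j) (lshift r i) != 0%N by rewrite mnmE b0 absz_eq0 gt_eqF.
  rewrite q0 expr0 mulr1 expr0n (negPf p0) mulr0 (drop_var_id q0).
  by move=> /addIr/esym/eqP; rewrite nz.
apply/allP=> m; rewrite exchange_polyD !ext_polyXmE.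
move=> /msuppD_le; rewrite mem_cat => /orP[] /msuppZ_le; rewrite msuppX inE => /eqP->.
  by rewrite !mnmE b0.
by rewrite !mnmE b0.
Qed.

(** By additivity of widths, a weight that is constant on a multiple of [F_j] is
    constant on [F_j], whose two exponents differ by column [j]. *)
Lemma ldvd_exchange_weight B j f w : ldvd (exchange_poly B j)%:F (ext_poly f : A)%:F ->
    f != 0 -> (forall a b, a \in msupp f -> b \in msupp f -> weight w a = weight w b) ->
  \sum_k w k * B k j = 0.
Proof.
rewrite exchange_polyE => /(ldvd_clear fvP)[a [m [q [g [qE qg]]]]] f0 fw.
have {qE} qE : q = 'X_[join_exponents 0 a] * binomial (B^~ j).
  apply: (ext_poly_inj fvP).
  by rewrite -qE rmorphM /= ext_poly_join mpolyX0 -!mul_mpolyC mulr1.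
have X0 : 'X_[m] != 0 :> {mpoly int[n + r]} by rewrite -msupp_eq0 msuppX.
have wE : weight w (pos_exp (B^~ j)) = weight w (neg_exp (B^~ j)).
  apply: (addrI (weight w (join_exponents 0 a))); rewrite -!weightD.
  apply: (divisor_width0 (g := q) (h := g)).
  - by rewrite qE mulX_binomial msupp_binomial eqxx.
  - by rewrite qE mulX_binomial msupp_binomial eqxx orbT.
  - by rewrite qg mulf_neq0.
  - move=> b c; rewrite qg => /msuppM_le/allpairsP[[b1 b2] [/= + b2f ->]].
    rewrite msuppX inE => /eqP->.
    move=> /msuppM_le/allpairsP[[c1 c2] [/= + c2f ->]].
    by rewrite msuppX inE => /eqP->; rewrite !weightD (fw _ _ b2f c2f).
by rewrite -weight_binomial wE subrr.
Qed.

Lemma ldvd_exchange_monomial B j m : unimodular_columns B ->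
  ~ ldvd (exchange_poly B j)%:F (ext_poly 'X_[m] : A)%:F.
Proof.
move=> Bu /ldvd_exchange_weight Fm; have [w] := Bu j; rewrite Fm //.
  by rewrite -msupp_eq0 msuppX.
by move=> a b; rewrite msuppX !inE => /eqP-> /eqP->.
Qed.

(** Parallel primitive columns would be linearly dependent. *)
Lemma ldvd_exchange B i j : unimodular_columns B -> free_columns B -> j != i ->
  ~ ldvd (exchange_poly B j)%:F (exchange_poly B i)%:F.
Proof.
move=> Bu Bf ji; rewrite [exchange_poly B i]exchange_polyE => Fij.
have orth (w : 'I_(n + r) -> int) : \sum_k w k * B k i = 0 -> \sum_k w k * B k j = 0.
  move=> wi; apply: (ldvd_exchange_weight Fij (binomial_neq0 _)).
  have wE : weight w (pos_exp (B^~ i)) = weight w (neg_exp (B^~ i)).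
    by apply/eqP; rewrite -subr_eq0 weight_binomial wi.
  by move=> a b; rewrite !msupp_binomial => /orP[]/eqP-> /orP[]/eqP->.
have pick2 (k l : 'I_(n + r)) (x y : int) (u : 'I_(n + r) -> int) :
    \sum_h (x * (h == k)%:Z - y * (h == l)%:Z) * u h = x * u k - y * u l.
  have pick z (h : 'I_(n + r)) : \sum_h' z * (h' == h)%:Z * u h' = z * u h.
    rewrite (bigD1 h) //= eqxx mulr1 big1 ?addr0 // => h' /negPf->.
    by rewrite mulr0 mul0r.
  by under eq_bigr => h _ do rewrite mulrBl; rewrite sumrB !pick.
have par k l : B l i * B k j = B k i * B l j.
  have := pick2 k l (B l i) (B k i) (B^~ j); rewrite orth; last first.
    by rewrite (pick2 k l _ _ (B^~ i)) mulrC subrr.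
  by move=> /esym/eqP; rewrite subr_eq0 => /eqP.
have B0 l : B l i = 0.
  pose v (h : 'I_n) := B l i * (h == j)%:Z - B l j * (h == i)%:Z.
  have := Bf v _ j; rewrite /v eqxx (negPf ji) mulr0 subr0 mulr1; apply=> k.
  rewrite (bigD1 j) //= (bigD1 i) 1?eq_sym //= big1 ?addr0.
    rewrite !eqxx eq_sym (negPf ji) !mulr1 !mulr0 subr0 sub0r.
    by rewrite mulrN mulrC par subrr.
  by move=> h /andP[/negPf-> /negPf->]; rewrite !mulr0 ?subrr ?mulr0.
have [w] := Bu i; rewrite big1 // => k _; by rewrite B0 mulr0.
Qed.

(** A factorization becomes one of integral polynomials; the Bezout relation of
    the column makes one of the factors a monomial. Its coefficient divides 1,
    and it involves no cluster variable as none divides [F_j]. *)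
Lemma exchange_irreducible B j : unimodular_columns B ->
  irreducible (exchange_poly B j).
Proof.
move=> Bu; split.
  apply/negP=> FU; apply: (ldvd_exchange_monomial (j := j) (m := 0%MM) Bu).
  exists ((exchange_poly B j)^-1)%:F; first exact/laurentP/tofrac_laurent.
  by rewrite -rmorphM mulVr // mpolyX0 !rmorph1.
move=> a b Fab; have [c [g aE]] := ext_poly_clear fvP a.
have [d [h bE]] := ext_poly_clear fvP b.
have [w wE] := Bu j; pose m := join_exponents (0%MM : 'X_{1..n}) (c + d)%MM.
have gh : g * h = 'X_[m] * binomial (B^~ j).
  apply: (ext_poly_inj fvP); rewrite !rmorphM /= -aE -bE ext_poly_join mpolyX0.
  rewrite -exchange_polyE Fab -!mul_mpolyC mulr1 mpolyXD !rmorphM /=.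
  by rewrite mulrACA.
have unitz (p q : {mpoly int[n + r]}) e : p * q = 'X_[m] * binomial (B^~ j) ->
    p = p@_e *: 'X_[e] -> p@_e \is a GRing.unit.
  move=> pq pE; apply/unitrPr; exists ('X_[e] * q)@_(m + pos_exp (B^~ j)).
  rewrite -mcoeffZ scalerAl -pE pq mulX_binomial mcoeffD !mcoeffX eqxx.
  case: eqP => // /(congr1 (weight w)); rewrite !weightD => /addrI wpn.
  by have := weight_binomial w (B^~ j); rewrite wpn subrr wE.
have unit_or p q k : p * q = exchange_poly B j -> ~ rdvd 'X_k p.
  move=> pq [p' pE]; apply: (@exchange_var_ndvd B j k).
  by exists (p' * q); rewrite -pq pE mulrAC.
have [| | |[e e0 gE]|[e e0 hE]] :=
  @primitive_segment_irreducible _ _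
    (m + pos_exp (B^~ j))%MM (m + neg_exp (B^~ j))%MM g h w.
- by move=> l; rewrite gh mulX_binomial msupp_binomial.
- by rewrite !weightD opprD addrACA subrr add0r weight_binomial.
- by rewrite gh mulf_neq0 ?binomial_neq0 // -msupp_eq0 msuppX.
- left; have cU := frozen_polyXm_unit fvP c.
  have [//|[k ka]] := monomial_unit_or_var fvP cU (unitz _ _ _ gh gE) aE gE.
  by case: (unit_or a b k).
- right; have dU := frozen_polyXm_unit fvP d; rewrite mulrC in gh.
  have [//|[k kb]] := monomial_unit_or_var fvP dU (unitz _ _ _ gh hE) bE hE.
  by case: (unit_or b a k); rewrite // mulrC.
Qed.

End ExchangePolynomials.

(** * Mutation of exchange polynomials *)

Section LPMutation.
Variables (S : idomainType) (n r : nat) (fv : 'I_r -> S).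
Hypothesis fvP : frozen_generators fv.
Local Notation A := {mpoly S[n]}.
Local Notation Q := {fraction {mpoly S[n]}}.
Local Notation ext_poly := (@ext_poly S n r fv).
Local Notation extQ := (@extQ S n r fv).
Implicit Types (B : 'M[int]_(n + r, n)) (i j : 'I_n) (e : 'I_(n + r) -> int).

Definition laurent_monomial e : Q := \prod_k extQ k ^ e k.

Lemma laurent_monomialD e e' :
  laurent_monomial e * laurent_monomial e' = laurent_monomial (fun k => e k + e' k).
Proof.
by rewrite -big_split; apply: eq_bigr => k _; rewrite expfzDr ?extQ_neq0.
Qed.

Lemma laurent_monomial_eq e e' :
  (forall k, e k = e' k) -> laurent_monomial e = laurent_monomial e'.
Proof. by move=> ee; apply: eq_bigr => k _; rewrite ee. Qed.

Lemma laurent_monomialX e (p : nat) :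
  laurent_monomial e ^+ p = laurent_monomial (fun k => p%:Z * e k).
Proof.
rewrite -prodrXl; apply: eq_bigr => k _.
by rewrite exprnP exprz_exp mulrC.
Qed.

Lemma tofrac_ext_monomial m :
  (ext_poly 'X_[m])%:F = laurent_monomial (fun k => (m k)%:Z).
Proof. by rewrite tofrac_extX. Qed.

Lemma laurent_monomial_split e : laurent_monomial e =
  cstQ n (\prod_(l < r) fv l ^ e (rshift n l)) *
  \prod_(k < n) @varQ S n k ^ e (lshift r k).
Proof.
rewrite /laurent_monomial big_split_ord /= mulrC; congr (_ * _).
  rewrite rmorph_prod; apply: eq_bigr => l _.
  by rewrite rmorphXz; [rewrite /extQ ext_var_rshift | case: fvP].
by apply: eq_bigr => k _; rewrite /extQ ext_var_lshift.
Qed.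

Definition var_exp i (k : 'I_(n + r)) : int :=
  if k == lshift r i then 1 else 0.

Lemma varQ_monomialV i : (@varQ S n i)^-1 = laurent_monomial (fun k => - var_exp i k).
Proof.
rewrite /laurent_monomial (bigD1 (lshift r i)) //= big1 => [|k /negPf ki].
  by rewrite /var_exp eqxx mulr1 /extQ ext_var_lshift.
by rewrite /var_exp ki expr0z.
Qed.

(** Exponents of the extended monomial that remains of [F_i] at [x_j = 0]. *)
Definition residue B i j (k : 'I_(n + r)) : int :=
  pospart (sgz (B (lshift r i) j) * B k i).

(** The exponent vector of the image of ['X_[m]] under the substitution of
    [residue / x_i'] for [x_i]. *)
Definition subst_exp B i j (m : 'X_{1..n + r}) (k : 'I_(n + r)) : int :=
  (drop_var i m k)%:Z + (m (lshift r i))%:Z * (residue B i j k - var_exp i k).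

Lemma eval_subst B i j m :
  mmap (@cstQ S n) (set_var i (laurent_monomial (residue B i j) / @varQ S n i))
    (ext_poly 'X_[m]) = laurent_monomial (subst_exp B i j m).
Proof.
by rewrite eval_set_var varQ_monomialV laurent_monomialD laurent_monomialX
  tofrac_ext_monomial laurent_monomialD.
Qed.

Lemma drop_varE i (m : 'X_{1..n + r}) k :
  (drop_var i m k)%:Z = if k == lshift r i then 0 else (m k)%:Z.
Proof. by rewrite mnmE; case: eqP. Qed.

Lemma subst_exp_mutate B i j k : skew_scaled B -> j != i ->
  subst_exp B i j (pos_exp (B^~ j)) k =
    subst_exp B i j (neg_exp (B^~ j)) k + mutate_matrix B i k j.
Proof.
move=> Bs ji; rewrite /subst_exp /var_exp; set i' := lshift r i.
have nE l : (neg_exp (B^~ j) l)%:Z = (pos_exp (B^~ j) l)%:Z - B l j.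
  by rewrite -[X in _ - X](mdiff_pos_neg (B^~ j)) /mdiff opprB addrC subrK.
have [->|ki] := eqVneq k i'.
  rewrite mutate_matrix_row !drop_varE !eqxx /residue skew_diag0 // mulr0 /pospart ltxx.
  by rewrite nE -/i'; ring.
rewrite mutate_matrixE // -/(residue B i j k) !drop_varE (negPf ki) subr0 !nE -/i'.
by ring.
Qed.

Lemma hat_at0_exchange B i j : skew_scaled B -> B (lshift r i) j != 0 ->
  mmap (@cstQ S n) (set_var j 0) (gexchange fv B i) = laurent_monomial (residue B i j).
Proof.
move=> Bs bij; have sg := skew_sgz i j Bs.
rewrite eval_exchange !eval_set_var; have [b0|b0|b0] := ltgtP (B (lshift r j) i) 0.
- have p0 : pos_exp (B^~ i) (lshift r j) = 0%N by rewrite mnmE (lt_gtF b0).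
  have q0 : neg_exp (B^~ i) (lshift r j) != 0%N.
    by rewrite mnmE oppr_gt0 b0 abszN absz_eq0 lt_eqF.
  rewrite p0 expr0 mulr1 expr0n (negPf q0) mulr0 addr0 drop_var_id //.
  rewrite tofrac_ext_monomial; apply: laurent_monomial_eq => k.
  by rewrite /residue sg (ltr0_sgz b0) opprK mul1r pos_expE.
- have q0 : neg_exp (B^~ i) (lshift r j) = 0%N by rewrite mnmE oppr_gt0 (lt_gtF b0).
  have p0 : pos_exp (B^~ i) (lshift r j) != 0%N by rewrite mnmE b0 absz_eq0 gt_eqF.
  rewrite q0 expr0 mulr1 expr0n (negPf p0) mulr0 add0r drop_var_id //.
  rewrite tofrac_ext_monomial; apply: laurent_monomial_eq => k.
  by rewrite /residue sg (gtr0_sgz b0) mulN1r neg_expE.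
- by move: bij; rewrite -sgz_eq0 sg b0 sgz0 oppr0 eqxx.
Qed.

Definition mutation_exp B i j (k : 'I_(n + r)) : int :=
  (neg_exp ((mutate_matrix B i)^~ j) k)%:Z - subst_exp B i j (neg_exp (B^~ j)) k.

(** Both sides are binomials whose two terms have the ratio given by column [j]
    of the mutated matrix. *)
Lemma mutation_monomial B i j : skew_scaled B -> j != i ->
  (gexchange fv (mutate_matrix B i) j)%:F =
    laurent_monomial (mutation_exp B i j) *
    mmap (@cstQ S n) (set_var i (laurent_monomial (residue B i j) / @varQ S n i))
      (gexchange fv B j).
Proof.
move=> Bs ji; rewrite eval_exchange !eval_subst exchange_polyD tofracD.
rewrite !tofrac_ext_monomial mulrDr !laurent_monomialD.
congr (_ + _); apply: laurent_monomial_eq => k; rewrite /mutation_exp ?subrK //.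
rewrite subst_exp_mutate // addrA subrK.
rewrite -[X in _ + X](mdiff_pos_neg ((mutate_matrix B i)^~ j)).
by rewrite /mdiff addrC subrK.
Qed.

(** The monomial relating [F_j'] to the substituted [F_j] avoids [x_j] because
    the [(i, j)] and [(j, i)] entries have opposite signs. *)
Lemma mutation_exp0 B i j : skew_scaled B -> j != i ->
  mutation_exp B i j (lshift r j) = 0.
Proof.
move=> Bs ji; have sg := skew_sgz i j Bs; rewrite /mutation_exp /subst_exp /var_exp.
rewrite !neg_expE !mnmE (inj_eq (@lshift_inj _ _)) (negPf ji) (skew_diag0 j Bs).
rewrite (skew_diag0 j (skew_mutate i Bs)) oppr0 ltxx /residue {1}/pospart ltxx subr0.
rewrite (_ : pospart (_ * _) = 0) ?mulr0 ?addr0 //.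
rewrite sg /pospart mulNr oppr_gt0; case: ifP => //.
by have [->|b0|b0] := sgzP (B (lshift r j) i); rewrite ?mul0r ?mul1r ?mulN1r; lia.
Qed.

(** If [F_i] involves [x_j], then modulo [F_j] only the term of [F_i] without
    [x_j] survives, and it is a monomial. *)
Lemma hat_exponent_exchange B i : unimodular_columns B -> free_columns B ->
  is_hat_exponent [ffun j => gexchange fv B j] i (fun=> 0).
Proof.
move=> Bu Bf; split=> // j ji; rewrite !ffunE leval0 /=.
set z := _ / _; have zL : z \in @laurent_pred S n.
  by apply/laurentP; exists (gexchange fv B j), U_(j)%MM.
split.
  apply/laurentP; apply: mmap_laurent => k; rewrite /set_var; case: eqP => // _.
  exact: tofrac_laurent.
have [b0|b0] := eqVneq (B (lshift r j) i) 0.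
  have Fj : free_of j (gexchange fv B i) by rewrite free_of_exchange ?b0.
  rewrite (mmap_free (@cstQ S n) (z := @varQ S n) Fj) => [|k /negPf kj]; last first.
    by rewrite /set_var kj.
  by rewrite mmap_varQ; apply: ldvd_exchange.
rewrite eval_exchange // !eval_set_var //.
have ldvd_z (m : 'X_{1..n + r}) : m (lshift r j) != 0%N ->
    ldvd (gexchange fv B j)%:F
      ((ext_poly 'X_[drop_var j m])%:F * z ^+ m (lshift r j)).
  case: (m _) => // p _.
  exists ((ext_poly 'X_[drop_var j m])%:F * z ^+ p / @varQ S n j).
    apply/laurentP; apply: (@rpredM _ (@laurent_pred S n)).
      apply: (@rpredM _ (@laurent_pred S n)); first exact: tofrac_laurent.
      exact: (@rpredX _ (@laurent_pred S n)).
    by apply/laurentP; exists 1, U_(j)%MM; rewrite rmorph1 mul1r.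
  by rewrite exprSr mulrA {2}/z mulrA mulrAC.
have [b1|b1|b1] := ltgtP (B (lshift r j) i) 0; last by rewrite b1 eqxx in b0.
  have p0 : pos_exp (B^~ i) (lshift r j) = 0%N by rewrite mnmE (lt_gtF b1).
  have q0 : neg_exp (B^~ i) (lshift r j) != 0%N.
    by rewrite mnmE oppr_gt0 b1 abszN absz_eq0 lt_eqF.
  rewrite addrC => /ldvd_sub/(_ (ldvd_z _ q0)).
  by rewrite p0 expr0 mulr1 drop_var_id //; apply: ldvd_exchange_monomial.
have q0 : neg_exp (B^~ i) (lshift r j) = 0%N by rewrite mnmE oppr_gt0 (lt_gtF b1).
have p0 : pos_exp (B^~ i) (lshift r j) != 0%N by rewrite mnmE b1 absz_eq0 gt_eqF.
move=> /ldvd_sub/(_ (ldvd_z _ p0)).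
by rewrite q0 expr0 mulr1 drop_var_id //; apply: ldvd_exchange_monomial.
Qed.

(** A divisor of a monomial is a monomial, which excludes irreducible elements
    not divisible by a variable: the frozen variables are units. *)
Lemma no_factor_of_monomial i j m p : ~ factor_of i j (ext_poly 'X_[m])%:F p.
Proof.
case=> -[pU _] _ pX /(ldvd_monomial fvP)[pU'|[k /pX//]].
by rewrite pU' in pU.
Qed.

(** The hat monomial is trivial, no factor is removed from the substituted
    polynomial, and the normalizing monomial is [mutation_exp], split into its
    frozen part, a unit of [S], and its part in the cluster variables. *)
Lemma exchange_LP_mutation B i (x x' : {ffun 'I_n -> _}) :
    skew_scaled B -> unimodular_columns B -> free_columns B ->
    x' i = mmap (@ground S n) x (gexchange fv B i) / x i ->
    (forall j, j != i -> x' j = x j) ->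
  LP_mutation (MkLPseed x [ffun j => gexchange fv B j]) i
    (MkLPseed x' [ffun j => gexchange fv (mutate_matrix B i) j]).
Proof.
move=> Bs Bu Bf x'i x'j; exists (fun=> 0); first exact: hat_exponent_exchange.
rewrite /=; split=> //.
- by rewrite ffunE leval0.
- by rewrite !ffunE; apply: exchange_sign; right=> k; rewrite mutate_matrix_col.
- move=> j ji; rewrite !ffunE free_of_exchange // => /eqP b0.
  exists 1; rewrite ?unitr1 // scale1r; apply: exchange_sign; left=> k.
  have [->|ki] := eqVneq k (lshift r i); first by rewrite mutate_matrix_row b0 oppr0.
  by rewrite mutate_matrixE // b0 mul0r addr0.
- move=> j ji; rewrite !ffunE free_of_exchange // => b0.
  rewrite /hat_at0 ffunE leval0 hat_at0_exchange //; split=> //.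
  + set c := laurent_monomial (residue B i j).
    have [m cE] : exists m, c = (ext_poly 'X_[m])%:F.
      exists (pos_exp (fun k => sgz (B (lshift r i) j) * B k i)).
      by rewrite tofrac_ext_monomial; apply: laurent_monomial_eq => k; rewrite pos_expE.
    exists (mmap (@cstQ S n) (set_var i (c / @varQ S n i)) (gexchange fv B j)); split.
      split.
      * apply/laurentP; apply: mmap_laurent => k; rewrite /set_var; case: eqP => _.
          by rewrite cE; apply/laurentP; exists (ext_poly 'X_[m]), U_(i)%MM.
        exact: tofrac_laurent.
      * by exists [::]; rewrite // big_nil rmorph1 mul1r.
      * by move=> p; rewrite cE => /no_factor_of_monomial.
    exists (\prod_(l < r) fv l ^ mutation_exp B i j (rshift n l)).
    exists (fun k => mutation_exp B i j (lshift r k)); split.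
    * apply: (big_ind (fun u : S => u \is a GRing.unit)).
      - exact: unitr1.
      - by move=> u v uU vU; rewrite unitrM uU.
      - by move=> l _; rewrite unitrXz //; case: fvP.
    * exact: mutation_exp0.
    * by rewrite mutation_monomial // laurent_monomial_split.
  + by rewrite free_of_exchange // (skew_diag0 j (skew_mutate i Bs)).
  + by move=> k; apply: exchange_var_ndvd.
Qed.

End LPMutation.

(** * Transcendence bases *)

Lemma divrKK (K : fieldType) (a b : K) : a != 0 -> a / (a / b) = b.
Proof. by move=> a0; rewrite invf_div mulrCA divff ?mulr1. Qed.

Section TranscendenceBasis.
Variables (S : idomainType) (n : nat).
Local Notation K := {fraction S}.
Local Notation F := {fraction {mpoly {fraction S}[n]}}.
Implicit Types (x y : 'I_n -> F) (p q : {mpoly K[n]}) (u v : F).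

Definition constF : {rmorphism K -> F} :=
  (@FracField.tofrac {mpoly K[n]} \o @mpolyC n K)%FUN.

Lemma eval_fracE x p : eval_frac x p = mmap constF x p.
Proof. by []. Qed.

Lemma eval_fracD x p q : eval_frac x (p + q) = eval_frac x p + eval_frac x q.
Proof. exact: (rmorphD (mmap constF x)). Qed.

Lemma eval_fracM x p q : eval_frac x (p * q) = eval_frac x p * eval_frac x q.
Proof. exact: (rmorphM (mmap constF x)). Qed.

Lemma eval_fracXn x p e : eval_frac x (p ^+ e) = eval_frac x p ^+ e.
Proof. exact: (rmorphXn (mmap constF x)). Qed.

Lemma eval_frac0 x : eval_frac x 0 = 0.
Proof. exact: (rmorph0 (mmap constF x)). Qed.

Lemma eval_frac1 x : eval_frac x 1 = 1.
Proof. exact: (rmorph1 (mmap constF x)). Qed.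

Lemma eval_fracX x k : eval_frac x 'X_k = x k.
Proof. by rewrite eval_fracE mmapX mmap1U. Qed.

Lemma eval_fracXm x m : eval_frac x 'X_[m] = \prod_k x k ^+ m k.
Proof. by rewrite eval_fracE mmapX. Qed.

Lemma eval_frac_sum x (s : seq 'X_{1..n}) (c : 'X_{1..n} -> K)
    (g : 'X_{1..n} -> {mpoly K[n]}) :
  eval_frac x (\sum_(m <- s) c m *: g m) =
    \sum_(m <- s) constF (c m) * eval_frac x (g m).
Proof.
elim: s => [|m s IHs]; first by rewrite !big_nil eval_frac0.
rewrite !big_cons eval_fracD IHs; congr (_ + _).
exact: (mmapZ x constF).
Qed.

Lemma eval_frac_msupp x p :
  eval_frac x p = \sum_(m <- msupp p) constF p@_m * eval_frac x 'X_[m].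
Proof. by rewrite {1}(mpolyE p) eval_frac_sum. Qed.

Lemma in_adjoin_fraction x u : in_adjoin x u ->
  exists p q, eval_frac x q != 0 /\ u = eval_frac x p / eval_frac x q.
Proof.
case=> p [q ->]; have [->|q0] := eqVneq (eval_frac x q) 0; last by exists p, q.
by exists 0, 1; rewrite eval_frac0 eval_frac1 oner_neq0 invr0 mulr0 mul0r.
Qed.

Lemma in_adjoinD x u v : in_adjoin x u -> in_adjoin x v -> in_adjoin x (u + v).
Proof.
move=> /in_adjoin_fraction[p [q [q0 ->]]] /in_adjoin_fraction[p' [q' [q'0 ->]]].
exists (p * q' + p' * q), (q * q').
by rewrite (addf_div _ _ q0 q'0) eval_fracD !eval_fracM.
Qed.

Lemma in_adjoinM x u v : in_adjoin x u -> in_adjoin x v -> in_adjoin x (u * v).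
Proof.
case=> p [q ->] [p' [q' ->]]; exists (p * p'), (q * q').
by rewrite mulf_div !eval_fracM.
Qed.

Lemma in_adjoinV x u : in_adjoin x u -> in_adjoin x u^-1.
Proof. by case=> p [q ->]; exists q, p; rewrite invf_div. Qed.

Lemma in_adjoin_eval x p : in_adjoin x (eval_frac x p).
Proof. by exists p, 1; rewrite eval_frac1 divr1. Qed.

Lemma in_adjoin_trans x y u : (forall k, in_adjoin y (x k)) ->
  in_adjoin x u -> in_adjoin y u.
Proof.
move=> yx; have const c : in_adjoin y (constF c).
  by have := in_adjoin_eval y c%:MP; rewrite eval_fracE mmapC.
have one : in_adjoin y 1 by have := const 1; rewrite rmorph1.
have poly p : in_adjoin y (eval_frac x p).
  rewrite /eval_frac /mmap; apply: big_ind => [||m _].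
  - by have := const 0; rewrite rmorph0.
  - exact: in_adjoinD.
  - apply: in_adjoinM; first exact: const.
    apply: big_ind => [||k _]; [exact: one | exact: in_adjoinM|].
    by elim: (m k) => [|e IHe]; rewrite ?expr0 // exprS; apply: in_adjoinM.
by case=> p [q ->]; apply: in_adjoinM; [|apply: in_adjoinV]; apply: poly.
Qed.

Variables (i : 'I_n) (f : {mpoly K[n]}) (x x' : 'I_n -> F).
Hypothesis f_neq0 : f != 0.
Hypothesis f_free : free_of i f.
Hypothesis x'i : x' i = eval_frac x f / x i.
Hypothesis x'j : forall j, j != i -> x' j = x j.

Let without (m : 'X_{1..n}) : 'X_{1..n} :=
  [multinom if k == i then 0%N else m k | k < n].

Let eval_free p : free_of i p -> eval_frac x' p = eval_frac x p.
Proof. by move=> pi; rewrite !eval_fracE; apply: mmap_free pi x'j. Qed.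

Let withoutE (y : 'I_n -> F) m :
  eval_frac y 'X_[m] = eval_frac y 'X_[without m] * y i ^+ m i.
Proof.
rewrite !eval_fracXm (bigD1 i) //= mulrC; congr (_ * _).
rewrite [RHS](bigD1 i) //= mnmE eqxx expr0 mul1r.
by apply: eq_bigr => k /negPf ki; rewrite mnmE ki.
Qed.

Let eval_without m : eval_frac x' 'X_[without m] = eval_frac x 'X_[without m].
Proof.
by apply: eval_free; apply/allP=> m'; rewrite msuppX inE => /eqP->; rewrite mnmE eqxx.
Qed.

(** As [f] is free of [x_i], the substitution [x_i -> f / x_i] is an involution.
    It turns a relation [p] between the new variables into a relation [p2]
    between the old ones, once denominators are cleared; so [p2] vanishes, and
    substituting in it once more gives [p] back up to a nonzero factor. *)
Lemma exchange_independent : (forall p, eval_frac x p = 0 -> p = 0) ->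
  forall p, eval_frac x' p = 0 -> p = 0.
Proof.
move=> xI p p0; have x_neq0 q : q != 0 -> eval_frac x q != 0.
  by move=> q0; apply: contra_neq q0 => /xI.
have f0 := x_neq0 _ f_neq0; have xi0 : x i != 0.
  by rewrite -eval_fracX; apply: x_neq0; rewrite -msupp_eq0 msuppX.
have x'i0 : x' i != 0 by rewrite x'i; exact: (mulf_neq0 f0 (invr_neq0 xi0)).
pose N := \max_(m <- msupp p) m i.
have mN m : m \in msupp p -> (m i <= N)%N by move=> mp; apply: leq_bigmax_seq.
pose T m := 'X_[without m] * f ^+ m i * 'X_i ^+ (N - m i) : {mpoly K[n]}.
have evalT y m : eval_frac y (T m) =
    eval_frac y 'X_[without m] * eval_frac y f ^+ m i * y i ^+ (N - m i).
  by rewrite !eval_fracM !eval_fracXn eval_fracX.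
(* T m is the numerator of 'X_[m] after the substitution, with a common
   denominator; this applies from x to x' and from x' to x *)
have scaleT y z b : b != 0 ->
    (forall m, eval_frac y 'X_[without m] = eval_frac z 'X_[without m]) ->
    eval_frac y f = b -> z i = b / y i -> y i != 0 ->
    forall m, m \in msupp p -> eval_frac y (T m) = y i ^+ N * eval_frac z 'X_[m].
  move=> b0 yz yf zi yi0 m /mN mi.
  rewrite evalT [eval_frac z 'X_[m]]withoutE yz yf zi mulrCA -mulrA.
  congr (_ * _); rewrite -[in RHS](subnK mi) exprD expr_div_n -mulrA.
  by rewrite [y i ^+ m i * _]mulrC divfK ?expf_neq0 // mulrC.
pose p2 := \sum_(m <- msupp p) p@_m *: T m.
have p20 : p2 = 0.
  apply: xI; transitivity (x i ^+ N * eval_frac x' p); last by rewrite p0 mulr0.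
  rewrite eval_frac_sum eval_frac_msupp mulr_sumr.
  apply: eq_big_seq => m mp; rewrite mulrCA; congr (_ * _).
  exact: (scaleT x x' _ f0 (fun m => esym (eval_without m)) (erefl _) x'i xi0 m mp).
apply: xI; apply: (mulfI (expf_neq0 N x'i0)).
transitivity (eval_frac x' p2); last first.
  by rewrite p20 eval_frac0 mulr0.
rewrite eval_frac_sum eval_frac_msupp mulr_sumr.
apply: eq_big_seq => m mp; rewrite mulrCA; congr (_ * _); apply/esym.
apply: (scaleT x' x _ f0 eval_without (eval_free f_free) _ x'i0 m mp).
by rewrite x'i; exact: esym (divrKK _ f0).
Qed.

Lemma exchange_transcendence_basis : transcendence_basis x -> transcendence_basis x'.
Proof.
move=> [xI xalg]; split; first exact: exchange_independent.
have xi0 : x i != 0.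
  rewrite -eval_fracX; have X0 : 'X_i != 0 :> {mpoly K[n]} by rewrite -msupp_eq0 msuppX.
  by apply: contra_neq X0 => /xI.
have f0 : eval_frac x f != 0 by apply: contra_neq f_neq0 => /xI.
move=> u; have [q [q0 qx qu]] := xalg u; exists q; split=> // k.
apply: in_adjoin_trans (qx k) => j.
have gen l : in_adjoin x' (x' l) by rewrite -eval_fracX; apply: in_adjoin_eval.
have [->|ji] := eqVneq j i; last by rewrite -x'j.
have -> : x i = eval_frac x' f * (x' i)^-1.
  by rewrite (eval_free f_free) x'i; exact: esym (divrKK _ f0).
by apply: in_adjoinM; [apply: in_adjoin_eval | apply: in_adjoinV].
Qed.

End TranscendenceBasis.

(** * Seeds of the cluster algebra *)

Section CoefficientField.
Variables (S : idomainType) (n : nat).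
Local Notation toK := (@FracField.tofrac S).
Implicit Type p : {mpoly S[n]}.

Lemma map_frac_neq0 p : p != 0 -> map_mpoly toK p != 0.
Proof.
apply: contra_neq => p0; apply/mpolyP=> m; rewrite mcoeff0; apply/eqP.
by rewrite -tofrac_eq0 -mcoeff_map_mpoly p0 mcoeff0.
Qed.

Lemma map_frac_free i p : free_of i p -> free_of i (map_mpoly toK p).
Proof.
move=> /allP pi; apply/allP=> m mp; apply: pi.
move: mp; rewrite !mcoeff_msupp mcoeff_map_mpoly; apply: contra_neq => ->.
exact: rmorph0.
Qed.

Lemma eval_map_frac x p : eval_frac x (map_mpoly toK p) = mmap (@ground S n) x p.
Proof.
apply: (mpoly_rmorph_ext (f := mmap (@constF S n) x \o map_mpoly toK)
          (g := mmap (@ground S n) x)) => [c|k].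
  by rewrite /= map_mpolyC ?rmorph0 // !mmapC.
by rewrite /= map_mpolyX !mmapX !mmap1U.
Qed.

End CoefficientField.

Section Seeds.
Variables n r : nat.
Local Notation S := (laurent int r).
Implicit Types (t : CAseed n r) (i j : 'I_n).

Definition good_seed t : Prop :=
  [/\ transcendence_basis (ca_cluster t), skew_scaled (ca_matrix t),
      unimodular_columns (ca_matrix t) & free_columns (ca_matrix t)].

Lemma exchange_gexchange (B : 'M[int]_(n + r, n)) j :
  exchange_poly B j = gexchange (@laurent_var int r) B j.
Proof. by []. Qed.

Lemma good_mutation t i : good_seed t -> good_seed (CA_mutation t i).
Proof.
have fvP := laurent_frozen r; case=> tb Bs Bu Bf; split=> /=; last 3 first.
- exact: skew_mutate.
- exact: unimodular_mutate.
- exact: free_mutate.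
pose f := gexchange (@laurent_var int r) (ca_matrix t) i.
have f0 : f != 0 by apply/irreducible_neq0/exchange_irreducible.
have fi : free_of i f by rewrite free_of_exchange // skew_diag0.
apply: (exchange_transcendence_basis (map_frac_neq0 f0) (map_frac_free fi)) tb.
  by rewrite ffunE eqxx eval_map_frac.
by move=> j /negPf ji; rewrite ffunE ji.
Qed.

Lemma good_reachable t0 t : good_seed t0 -> CA_reachable t0 t -> good_seed t.
Proof. by move=> t0P; elim=> // t1 i _; apply: good_mutation. Qed.

Lemma LPseed_good t : good_seed t -> is_LPseed (LPseed_of t).
Proof.
have fvP := laurent_frozen r.
case=> tb Bs Bu Bf; split=> // [i|i j|i] /=; rewrite ffunE exchange_gexchange.
- exact: exchange_irreducible.
- exact: exchange_var_ndvd.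
- by rewrite free_of_exchange // skew_diag0.
Qed.

Lemma LP_mutation_good t i :
  good_seed t -> LP_mutation (LPseed_of t) i (LPseed_of (CA_mutation t i)).
Proof.
case=> _ Bs Bu Bf.
apply: (exchange_LP_mutation (laurent_frozen r)) => // [|j /negPf ji].
  by rewrite ffunE eqxx.
by rewrite ffunE ji.
Qed.

(** The exchange polynomials determine the columns of the matrix up to sign, and
    mutation is compatible with these signs. *)
Lemma LPseed_of_mutation t1 t2 i : good_seed t1 -> good_seed t2 ->
    LPseed_of t1 = LPseed_of t2 ->
  LPseed_of (CA_mutation t1 i) = LPseed_of (CA_mutation t2 i).
Proof.
move=> [_ B1 _ _] [_ B2 _ _] [xE FE].
have FjE j : exchange_poly (ca_matrix t1) j = exchange_poly (ca_matrix t2) j.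
  by have /ffunP/(_ j) := FE; rewrite !ffunE.
have BE : same_columns_up_to_sign (ca_matrix t1) (ca_matrix t2).
  move=> j; apply: binomial_eq; apply: (ext_poly_inj (laurent_frozen r) (n := n)).
  by rewrite -!exchange_polyE; apply: FjE.
rewrite /LPseed_of /= xE FjE; congr MkLPseed; apply/ffunP=> j; rewrite !ffunE.
exact: exchange_sign (mutate_columns_up_to_sign i B1 B2 BE j).
Qed.

Variable t0 : CAseed n r.
Hypothesis t0_good : good_seed t0.

(** The seed chosen over [s] does not matter, by [LPseed_of_mutation]. *)
Definition LP_choice (s : LPseed S n) (i : 'I_n) : LPseed S n :=
  if pselect (CA_LPseeds t0 s) is left sP
  then LPseed_of (CA_mutation (s2val (cid2 sP)) i) else s.

Lemma LP_choiceE t i : CA_reachable t0 t ->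
  LP_choice (LPseed_of t) i = LPseed_of (CA_mutation t i).
Proof.
move=> tP; rewrite /LP_choice; case: pselect => [sP|[]]; last by exists t.
case: (cid2 sP) => t1 /= t1P tE; apply: LPseed_of_mutation (esym tE).
  exact: good_reachable t1P.
exact: good_reachable tP.
Qed.

Lemma LP_choice_connected t : CA_reachable t0 t ->
  clos_refl_sym_trans (LPseed S n)
    (fun s1 s2 => CA_LPseeds t0 s1 /\ exists i, s2 = LP_choice s1 i)
    (LPseed_of t0) (LPseed_of t).
Proof.
elim=> [|t1 i t1P IH]; first exact: rst_refl.
apply: rst_trans IH _; apply: rst_step; split; first by exists t1.
by exists i; rewrite LP_choiceE.
Qed.

End Seeds.

Lemma generated_subring_mono (S : idomainType) n
    (G G' : {fraction {mpoly {fraction S}[n]}} -> Prop) u :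
  (forall g, G g -> G' g) -> generated_subring G u -> generated_subring G' u.
Proof.
move=> GG'; elim=> [s|g /GG'|v w _ IHv _|v w _ IHv _].
- exact: generated_ground.
- exact: generated_gen.
- exact: generated_sub.
- exact: generated_mul.
Qed.

Theorem proposition4p4 (n r : nat) (t0 : CAseed n r) :
  (0 < n)%N ->
  is_CAseed t0 -> primitive (ca_matrix t0) -> full_rank (ca_matrix t0) ->
  is_LP_algebra (cluster_algebra t0) (CA_LPseeds t0) /\
  (forall (t : CAseed n r) (i : 'I_n), CA_reachable t0 t ->
     LP_mutation (LPseed_of t) i (LPseed_of (CA_mutation t i))).
Proof.
move=> _ [tb Bs] Bp Bf.
have t0P : good_seed t0.
  split=> //; [exact: skew_symmetrizable_scaled | exact: primitive_unimodular |].
  exact: full_rank_free.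
have mutP t i : CA_reachable t0 t ->
    LP_mutation (LPseed_of t) i (LPseed_of (CA_mutation t i)).
  by move=> tP; apply/LP_mutation_good/(good_reachable t0P).
split=> //; split.
- exact/factorial_UFD/laurent_factorial/int_factorial.
- by move=> _ [t tP ->]; apply/LPseed_good/(good_reachable t0P).
- exists (LP_choice t0); split=> [_ i [t tP ->]|_ _ [t tP ->] [t' t'P ->]].
    rewrite LP_choiceE //; split; last exact: mutP.
    by exists (CA_mutation t i) => //; apply: reach_step.
  apply: rst_trans (LP_choice_connected t0P t'P).
  exact/rst_sym/LP_choice_connected.
- move=> u; split; apply: generated_subring_mono => g.
    move=> [t [tP [i ->]]]; exists (LPseed_of t); split; first by exists t.
    by exists i.
  by move=> [_ [[t tP ->] [i ->]]]; exists t; split=> //; exists i.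
Qed.
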